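(* Let $d\ge 1$ and let $(\mathbf X,\mathbf X')\in\mathbb H^d\times\mathbb H^d$ be a matrix Stein pair with conditional variance $\mathbf\Delta_{\mathbf X}$. Suppose there exist constants $c,v\ge 0$ such that $$\mathbf\Delta_{\mathbf X}\preccurlyeq c\,\mathbf X+v\,\mathbf I\qquad\text{almost surely}.$$ Then, for all $t\ge 0$, $$\mathbb P\{\lambda_{\min}(\mathbf X)\le -t\}\le d\cdot\exp\Big\{\frac{-t^2}{2v}\Big\},$$ $$\mathbb P\{\lambda_{\max}(\mathbf X)\ge t\}\le d\cdot\exp\Big\{-\frac tc+\frac v{c^2}\log\Big(1+\frac{ct}{v}\Big)\Big\}\le d\cdot\exp\Big\{\frac{-t^2}{2v+2ct}\Big\}.$$ Furthermore, $$\mathbb E\,\lambda_{\min}(\mathbf X)\ge-\sqrt{2v\log d},\qquad \mathbb E\,\lambda_{\max}(\mathbf X)\le\sqrt{2v\log d}+c\log d.$$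
   Context: $\mathbb H^d$ is the space of $d\times d$ complex Hermitian matrices; $\mathbf A\preccurlyeq\mathbf B$ means $\mathbf B-\mathbf A$ is positive semidefinite; $\lambda_{\max},\lambda_{\min}$ are the largest and smallest eigenvalues; $\|\cdot\|$ is the spectral norm; $\mathbf I$ is the identity matrix. Exchangeable pair: random variables $Z,Z'$ taking values in a Polish space $\mathcal Z$ form an exchangeable pair if $(Z,Z')$ and $(Z',Z)$ have the same distribution. Matrix Stein pair: let $(Z,Z')$ be an exchangeable pair in a Polish space $\mathcal Z$, let $\mathbf\Psi:\mathcal Z\to\mathbb H^d$ be measurable, and set $\mathbf X=\mathbf\Psi(Z)$, $\mathbf X'=\mathbf\Psi(Z')$. The pair $(\mathbf X,\mathbf X')$ is a matrix Stein pair with scale factor $\alpha\in(0,1]$ if $\mathbb E[\mathbf X-\mathbf X'\mid Z]=\alpha\mathbf X$ almost surely; it is always assumed that $\mathbb E\|\mathbf X\|^2<\infty$. Conditional variance: $\mathbf\Delta_{\mathbf X}=\frac1{2\alpha}\mathbb E[(\mathbf X-\mathbf X')^2\mid Z]$ (any version). Convention for degenerate parameters: when $c=0$ the middle expression is read as its limit as $c\to0^+$, namely $d\exp\{-t^2/(2v)\}$; when $v=0$ the expressions are read as their limits as $v\to0^+$ (and at $t=0$ the exponents are read as $0$). *)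

(* Defs.v *)
From HB Require Import structures.
From mathcomp Require Import all_boot all_order all_algebra.
From mathcomp Require Import sesquilinear spectral.
From mathcomp Require Import all_classical all_reals all_analysis.
From mathcomp Require Import complex.
Import Order.TTheory GRing.Theory Num.Theory.
Import numFieldNormedType.Exports.

Set Implicit Arguments.
Unset Strict Implicit.
Unset Printing Implicit Defensive.

Local Open Scope classical_set_scope.
Local Open Scope ring_scope.
Local Open Scope sesquilinear_scope.
Local Open Scope complex_scope.

(** * Hermitian matrices *)

Section matrices.
Context {R : realType} {d : nat}.
Implicit Types A B : 'M[R[i]]_d.

(* The order on [R[i]] is partial: [0 <= z] means that [z] is real and
   nonnegative. *)
Definition psd A : Prop :=
  A \is hermsymmx /\ forall x : 'cV[R[i]]_d, 0 <= (x ^t* *m A *m x) 0 0.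

Definition loewner_le A B : Prop := psd (B - A).

(* For Hermitian [A] and [0 < d], the set of eigenvalues is finite and nonempty,
   and all eigenvalues are real: the sup and inf are a max and a min. *)
Definition lambda_max A : R := sup [set x : R | eigenvalue A x%:C].
Definition lambda_min A : R := inf [set x : R | eigenvalue A x%:C].

Definition l2norm (x : 'cV[R[i]]_d) : R :=
  Num.sqrt (\sum_(k < d) (complex.Re `|x k 0|) ^+ 2).

Definition spectral_norm A : R :=
  sup [set l2norm (A *m x) | x in [set x : 'cV[R[i]]_d | l2norm x = 1]].

End matrices.

(** * Polish spaces *)

Definition separable (T : topologicalType) : Prop :=
  exists2 S : set T, countable S & dense S.

Definition is_metric (R : realType) (T : Type) (dist : T -> T -> R) : Prop :=
  [/\ forall x y, 0 <= dist x y,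
      forall x y, dist x y = 0 <-> x = y,
      forall x y, dist x y = dist y x &
      forall x y z, dist x z <= dist x y + dist y z].

Definition induces_topology (R : realType) (T : topologicalType)
    (dist : T -> T -> R) : Prop :=
  forall (x : T) (A : set T),
    nbhs x A <-> exists2 e : R, 0 < e & [set y | dist x y < e] `<=` A.

Definition complete_metric (R : realType) (T : topologicalType)
    (dist : T -> T -> R) : Prop :=
  forall u : nat -> T,
    (forall e : R, 0 < e -> exists N : nat, forall m n : nat,
       (N <= m)%N -> (N <= n)%N -> dist (u m) (u n) < e) ->
    exists l : T, u @ \oo --> l.

Definition polish (R : realType) (T : topologicalType) : Prop :=
  separable T /\
  exists dist : T -> T -> R,
    [/\ is_metric dist, induces_topology dist & complete_metric dist].

(* A Polish space with its Borel sigma-algebra. Since a Polish space is second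
   countable, the product sigma-algebra on [borel T * borel T] is the Borel
   sigma-algebra of the product space. *)
Notation borel T := (g_sigma_algebraType (@open T)).

(** * Random matrices and conditional expectations *)

Definition mx_measurable (R : realType) (d : nat) (disp : measure_display)
    (S : measurableType disp) (F : S -> 'M[R[i]]_d) : Prop :=
  forall i j, measurable_fun [set: S] (fun s => complex.Re (F s i j)) /\
              measurable_fun [set: S] (fun s => complex.Im (F s i j)).

Section probability.
Context {R : realType} {dO : measure_display} {Omega : measurableType dO}.
Variable P : probability Omega R.

Section conditional_expectation.
Context {dT : measure_display} {T : measurableType dT}.
Variable Z : Omega -> T.

(* [W] is a version of E[Y | Z]; [g_sigma_algebra_preimageType Z] is [Omega]
   endowed with sigma(Z). *)
Definition is_cond_exp (Y W : Omega -> R) : Prop :=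
  [/\ P.-integrable [set: Omega] (EFin \o Y),
      P.-integrable [set: Omega] (EFin \o W),
      measurable_fun [set: g_sigma_algebra_preimageType Z]
        (W : g_sigma_algebra_preimageType Z -> R) &
      forall B : set T, measurable B ->
        (\int[P]_(w in Z @^-1` B) (W w)%:E =
         \int[P]_(w in Z @^-1` B) (Y w)%:E)%E].

Definition is_mx_cond_exp (d : nat) (Y W : Omega -> 'M[R[i]]_d) : Prop :=
  forall i j,
    is_cond_exp (fun w => complex.Re (Y w i j)) (fun w => complex.Re (W w i j)) /\
    is_cond_exp (fun w => complex.Im (Y w i j)) (fun w => complex.Im (W w i j)).

End conditional_expectation.

Definition exchangeable_pair (dT : measure_display) (T : measurableType dT)
    (Z Z' : Omega -> T) : Prop :=
  forall B : set (T * T), measurable B ->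
    pushforward P (fun w => (Z w, Z' w)) B =
    pushforward P (fun w => (Z' w, Z w)) B.

Context {T : ptopologicalType} {d : nat}.

(* As [alpha X] is sigma(Z)-measurable, the almost sure identity
   E[X - X' | Z] = alpha X says that [alpha X] is a version of E[X - X' | Z]. *)
Record matrix_stein_pair (Z Z' : {RV P >-> borel T}) (Psi : T -> 'M[R[i]]_d)
    (alpha : R) (X X' : Omega -> 'M[R[i]]_d) : Prop := MatrixSteinPair {
  stein_polish : polish R T ;
  stein_exchangeable : exchangeable_pair Z Z' ;
  stein_hermitian : forall z, Psi z \is hermsymmx ;
  stein_measurable : mx_measurable (Psi : borel T -> 'M[R[i]]_d) ;
  stein_left : forall w, X w = Psi (Z w) ;
  stein_right : forall w, X' w = Psi (Z' w) ;
  stein_scale : 0 < alpha <= 1 ;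
  stein_moment : ('E_P[fun w => (spectral_norm (X w) ^+ 2)%R] < +oo)%E ;
  stein_identity :
    is_mx_cond_exp Z (fun w => X w - X' w) (fun w => alpha%:C *: X w)
}.

Definition is_cond_variance (Z : Omega -> borel T) (alpha : R)
    (X X' Delta : Omega -> 'M[R[i]]_d) : Prop :=
  exists2 W : Omega -> 'M[R[i]]_d,
    is_mx_cond_exp Z (fun w => (X w - X' w) *m (X w - X' w)) W &
    forall w, Delta w = ((2 * alpha)^-1)%:C *: W w.

End probability.

(** * Tail bounds *)

Section tails.
Context {R : realType}.
Implicit Types c v t : R.

(* The value at [v] of a function of a nonnegative parameter, read as the limit
   from the right when [v = 0]. *)
Definition right_ext (f : R -> R) v : R :=
  if v == 0 then lim (f u @[u --> 0^'+]) else f v.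

(* For [t = 0] these three functions are constantly 1, also when [v = 0]. *)

Definition gauss_tail v t : R :=
  right_ext (fun u => expR (- t ^+ 2 / (2 * u))) v.

Definition log_tail c v t : R :=
  right_ext (fun u =>
    if c == 0 then expR (- t ^+ 2 / (2 * u))
    else expR (- (t / c) + u / c ^+ 2 * ln (1 + c * t / u))) v.

Definition bernstein_tail c v t : R :=
  right_ext (fun u => expR (- t ^+ 2 / (2 * u + 2 * c * t))) v.

End tails.

(* Main.v *)
Require Import Defs.
From HB Require Import structures.
From mathcomp Require Import all_boot all_order all_algebra.
From mathcomp Require Import sesquilinear spectral.
From mathcomp Require Import all_classical all_reals all_analysis.
From mathcomp Require Import complex.
From mathcomp Require Import measurable_realfun.
From mathcomp Require Import ring lra.
Import Order.TTheory GRing.Theory Num.Theory.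
Import numFieldNormedType.Exports.

Set Implicit Arguments.
Unset Strict Implicit.
Unset Printing Implicit Defensive.

Local Open Scope classical_set_scope.
Local Open Scope ring_scope.
Local Open Scope sesquilinear_scope.
Local Open Scope complex_scope.

(* For [W = X] or [W = - X] one bounds the trace moment generating function
   [m(theta) = E tr exp(theta min(W, L))], where the truncation at level [L]
   removes all questions of integrability and is harmless: Markov's inequality
   is applied with [L = t].

   Put [h(x) = exp(theta min(x, L))].  Exchangeability and the Stein identity
   give [E tr W h(W) = (2 alpha)^-1 E tr (W - W')(h(W) - h(W'))].  Expanding
   traces in the two eigenbases, the scalar inequality
   [(x - y)(h x - h y) <= (theta / 2) (x - y)^2 (h x + h y)] bounds this by
   [theta E tr Delta h(W) <= theta E tr (c W + v) h(W)].  Hence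
   [(1 - c theta) E tr W h(W) <= v theta m(theta)], which is
   [(ln m)' <= v theta / (1 - c theta)]; as [min(W, L) <= W] and [exp] lies
   above its tangents, this can be integrated along finite subdivisions, without
   differentiating under the expectation. *)

(** * Functional calculus of Hermitian matrices *)

(** No exponential moment of [X] is assumed, so [exp(theta X)] need not be integrable, whereas [h]
    is bounded for every [L] and the resulting bounds on [m] do not depend on [L]. Truncation spoils
    the smoothness of [h], but [min(x, L)] stays nondecreasing and 1-Lipschitz, which is all that
    the scalar inequality needs; its factor 1/2 is that of the trapezoid rule for the convex
    function [exp].

    Eigenbases are chosen matrix by matrix, with no control on how they vary with the sample point.
    Measurability therefore has to come from the functional calculus itself, through polynomials and
    pointwise limits.

    The dimension enters as [m(0) = d]. The tail bound takes [theta = t / (v + c t)]. For [- X] the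
    constant [c] becomes [- c], and the denominator [1 + c theta >= 1] may be replaced by 1: this is
    why the lower tail is Gaussian. When [v = 0] the inequality is weakened to each [u > 0] before
    [u] tends to 0. *)

Section unitary_diagonal.
Context {C : numClosedFieldType} {d : nat}.
Implicit Types (U V A B : 'M[C]_d) (a b : 'I_d -> C) (f : C -> C).

Definition udiag U a : 'M[C]_d := U ^t* *m diag_mx (\row_k a k) *m U.

Lemma diag_mulE a (M : 'M[C]_d) i j :
  (diag_mx (\row_k a k) *m M) i j = a i * M i j.
Proof. by rewrite mul_diag_mx !mxE. Qed.

Lemma mul_diagE a (M : 'M[C]_d) i j :
  (M *m diag_mx (\row_k a k)) i j = M i j * a j.
Proof. by rewrite mul_mx_diag !mxE. Qed.

Lemma udiagE U a i j :
  udiag U a i j = \sum_k a k * ((U k i)^* * U k j)%R.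
Proof.
rewrite /udiag mxE; apply: eq_bigr => k _.
by rewrite mul_mx_diag !mxE [X in X * _]mulrC -mulrA.
Qed.

Lemma unitary_mulV U : U \is unitarymx -> U *m U ^t* = 1%:M.
Proof. by move/unitarymxP. Qed.

Lemma unitary_Vmul U : U \is unitarymx -> U ^t* *m U = 1%:M.
Proof. by move=> uU; rewrite -(invmx_unitary uU) mulVmx ?unitarymx_unit. Qed.

Lemma udiagM U a b : U \is unitarymx ->
  udiag U a *m udiag U b = udiag U (fun k => a k * b k).
Proof.
move=> uU; rewrite /udiag !mulmxA; congr (_ *m _).
rewrite -[_ *m U *m U ^t*]mulmxA unitary_mulV // mulmx1 -mulmxA mulmx_diag.
by congr (_ *m diag_mx _); apply/rowP => k; rewrite !mxE.
Qed.

Lemma udiagD U a b : udiag U a + udiag U b = udiag U (fun k => a k + b k).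
Proof.
apply/matrixP => i j; rewrite mxE !udiagE -big_split /=.
by apply: eq_bigr => k _; rewrite mulrDl.
Qed.

Lemma udiagZ U (x : C) a : x *: udiag U a = udiag U (fun k => x * a k).
Proof.
apply/matrixP => i j; rewrite mxE !udiagE mulr_sumr.
by apply: eq_bigr => k _; rewrite mulrA.
Qed.

Lemma udiag_cst U (x : C) : U \is unitarymx -> udiag U (fun=> x) = x%:M.
Proof.
move=> uU; rewrite /udiag (_ : diag_mx _ = x%:M); last first.
  by rewrite -diag_const_mx; congr diag_mx; apply/rowP => k; rewrite !mxE.
by rewrite -mulmxA mul_scalar_mx -scalemxAr unitary_Vmul // scalemx1.
Qed.

(** Multiplying by [U] on the left and by [V ^t*] on the right moves both unitaries into
    [W = U V^*]; the resulting equation between products with diagonal matrices is then read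
    entrywise. *)
Lemma udiag_intertwine U V a b : U \is unitarymx -> V \is unitarymx ->
  udiag U a = udiag V b <->
  forall i j, a i * (U *m V ^t*) i j = (U *m V ^t*) i j * b j.
Proof.
move=> uU uV; set W := U *m V ^t*.
have eW : (diag_mx (\row_k a k) *m W = W *m diag_mx (\row_k b k)) <->
    forall i j, a i * W i j = W i j * b j.
  split=> [/matrixP e i j|e]; last apply/matrixP => i j.
    by have := e i j; rewrite diag_mulE mul_diagE.
  by rewrite diag_mulE mul_diagE.
rewrite -eW; split=> e.
  have -> : diag_mx (\row_k a k) *m W = U *m udiag U a *m V ^t*.
    by rewrite /udiag !mulmxA unitary_mulV // mul1mx.
  by rewrite e /udiag /W -!mulmxA unitary_mulV // mulmx1.
rewrite /udiag -[LHS]mulmx1 -(unitary_Vmul uV) !mulmxA -[_ *m U *m _]mulmxA.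
rewrite -/W -[_ *m _ *m W]mulmxA e /W !mulmxA.
by rewrite unitary_Vmul // mul1mx.
Qed.

(* The unitary [U V^*] intertwines the two diagonal matrices, hence it only
   connects equal eigenvalues. *)
Lemma udiag_map U V a b f : U \is unitarymx -> V \is unitarymx ->
  udiag U a = udiag V b -> udiag U (f \o a) = udiag V (f \o b).
Proof.
move=> uU uV /(udiag_intertwine _ _ uU uV) eab.
apply/(udiag_intertwine _ _ uU uV) => i j /=; have := eab i j.
have [W0|W0] := eqVneq ((U *m V ^t*) i j) 0; first by rewrite W0 !mulr0 !mul0r.
by rewrite mulrC => /(mulfI W0) ->; rewrite mulrC.
Qed.

Lemma udiag_herm U a : (forall k, a k \is Num.real) ->
  udiag U a \is hermsymmx.
Proof.
move=> a_real; apply/is_hermitianmxP; rewrite expr0 scale1r.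
apply/matrixP => i j; rewrite [RHS]mxE [in RHS]mxE !udiagE rmorph_sum /=.
apply: eq_bigr => k _; rewrite !rmorphM /= conjCK (conj_Creal (a_real k)).
by congr (_ * _); rewrite mulrC.
Qed.

Lemma hermitian_udiag A : A \is hermsymmx ->
  A = udiag (spectralmx A) (fun k => spectral_diag A 0 k).
Proof.
move=> hA; have /hermitian_normalmx/orthomx_spectralP {1}-> := hA.
rewrite /udiag (invmx_unitary (spectral_unitarymx A)).
by congr (_ *m diag_mx _ *m _); apply/rowP => k; rewrite !mxE.
Qed.

Lemma mxtrace_mul_udiag M U a :
  \tr (M *m udiag U a) = \sum_k a k * (U *m M *m U ^t*) k k.
Proof.
rewrite /udiag mulmxA mxtrace_mulC !mulmxA; apply: eq_bigr => k _.
by rewrite mul_diagE mulrC.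
Qed.

(** The weights are the squared overlaps of the two eigenbases. Their nonnegativity is what lets
    scalar inequalities pass to traces of noncommuting matrices. *)
Lemma mxtrace_udiag2 U V a b :
  \tr (udiag U a *m udiag V b) =
  \sum_k \sum_j a j * b k * `|(U *m V ^t*) j k| ^+ 2.
Proof.
rewrite mxtrace_mul_udiag; apply: eq_bigr => k _.
have -> : V *m udiag U a *m V ^t* = udiag (U *m V ^t*) a.
  by rewrite /udiag trmx_mul map_mxM /= trmxCK !mulmxA.
rewrite udiagE mulr_sumr; apply: eq_bigr => j _.
by rewrite normCK [_^* * _]mulrC mulrA [b k * _]mulrC.
Qed.

(** Inserting the identity, diagonal in the other basis, gives a trace in one basis the same
    double-sum form as the mixed traces, so that they can be combined termwise. *)
Lemma mxtrace_udiagl U V a : U \is unitarymx -> V \is unitarymx ->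
  \tr (udiag U a) = \sum_k \sum_j a j * `|(U *m V ^t*) j k| ^+ 2.
Proof.
move=> uU uV; rewrite -[udiag U a]mulmx1 -(udiag_cst 1 uV) mxtrace_udiag2.
by apply: eq_bigr => k _; apply: eq_bigr => j _; rewrite mulr1.
Qed.

Lemma mxtrace_udiagr U V b : U \is unitarymx -> V \is unitarymx ->
  \tr (udiag V b) = \sum_k \sum_j b k * `|(U *m V ^t*) j k| ^+ 2.
Proof.
move=> uU uV; rewrite -[udiag V b]mul1mx -(udiag_cst 1 uU) mxtrace_udiag2.
by apply: eq_bigr => k _; apply: eq_bigr => j _; rewrite mul1r.
Qed.

Lemma mxtrace_mulBB U V a b a' b' : U \is unitarymx -> V \is unitarymx ->
  \tr ((udiag U a - udiag V b) *m (udiag U a' - udiag V b')) =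
  \sum_k \sum_j (a j - b k) * (a' j - b' k) * `|(U *m V ^t*) j k| ^+ 2.
Proof.
move=> uU uV; rewrite mulmxBl !mulmxBr !raddfB /=.
rewrite [\tr (udiag V b *m udiag U a')]mxtrace_mulC.
rewrite !(udiagM _ _ uU) !(udiagM _ _ uV) !mxtrace_udiag2.
rewrite (mxtrace_udiagl _ uU uV) (mxtrace_udiagr _ uU uV).
rewrite opprK [- _ + _]addrC -!sumrB -big_split; apply: eq_bigr => k _ /=.
rewrite -!sumrB -big_split; apply: eq_bigr => j _ /=.
by ring.
Qed.

(** The cyclic rearrangement is made for [A] and [M] diagonal in a common basis: each trace then has
    at most one factor from each of the two bases. *)
Lemma mxtrace_sqrB A B M : \tr ((A - B) *m (A - B) *m M) =
  (\tr (A *m A *m M) - \tr (M *m A *m B)) +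
  (\tr (M *m (B *m B)) - \tr (A *m M *m B)).
Proof.
rewrite [(A - B) *m (A - B)]mulmxBl !mulmxBr !mulmxBl !raddfB /= !opprK.
rewrite [\tr (A *m B *m M)]mxtrace_mulC [\tr (B *m B *m M)]mxtrace_mulC.
rewrite -[B *m A *m M]mulmxA [\tr (B *m (A *m M))]mxtrace_mulC.
by rewrite [M *m (A *m B)]mulmxA; ring.
Qed.

Lemma mxtrace_sqrB_mull U V a b c : U \is unitarymx -> V \is unitarymx ->
  \tr ((udiag U a - udiag V b) *m (udiag U a - udiag V b) *m udiag U c) =
  \sum_k \sum_j (a j - b k) ^+ 2 * c j * `|(U *m V ^t*) j k| ^+ 2.
Proof.
move=> uU uV; rewrite mxtrace_sqrB !(udiagM _ _ uU) !(udiagM _ _ uV).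
rewrite !mxtrace_udiag2 (mxtrace_udiagl _ uU uV) -!sumrB -big_split.
apply: eq_bigr => k _; rewrite -!sumrB -big_split; apply: eq_bigr => j _ /=.
by ring.
Qed.

Lemma mxtrace_sqrB_mulr U V a b c : U \is unitarymx -> V \is unitarymx ->
  \tr ((udiag U a - udiag V b) *m (udiag U a - udiag V b) *m udiag V c) =
  \sum_k \sum_j (a j - b k) ^+ 2 * c k * `|(U *m V ^t*) j k| ^+ 2.
Proof.
move=> uU uV; rewrite -[udiag U a - udiag V b]opprB mulmxN !mulNmx opprK.
rewrite (mxtrace_sqrB_mull _ _ _ uV uU) exchange_big /=.
apply: eq_bigr => k _; apply: eq_bigr => j _; congr (_ * _ * _ ^+ 2).
  by rewrite -sqrrN opprB.
have -> : V *m U ^t* = (U *m V ^t*) ^t* by rewrite trmx_mul map_mxM /= trmxCK.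
by move: (U *m V ^t*) => W; rewrite !mxE norm_conjC.
Qed.

(** Eigenvectors are row vectors here. Right multiplication by [U ^t*] reduces to a diagonal matrix,
    where any nonzero coordinate identifies the eigenvalue; conversely the rows of [U] are
    eigenvectors. *)
Lemma eigenvalue_udiag U a x : U \is unitarymx ->
  eigenvalue (udiag U a) x <-> exists k, a k = x.
Proof.
move=> uU; split=> [/eigenvalueP[v]|[k <-]].
  move/(congr1 (mulmx^~ (U ^t*))); rewrite -scalemxAl /udiag.
  rewrite !mulmxA -[_ *m U *m _]mulmxA unitary_mulV // mulmx1.
  rewrite -[v in v != 0]mulmx1 -(unitary_Vmul uU) mulmxA.
  move: (v *m U ^t*) => w e wU.
  have [k wk] : exists k, w 0 k != 0.
    apply/existsP; apply: contraNT wU; rewrite negb_exists => /forallP w0.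
    rewrite (_ : w = 0) ?mul0mx //; apply/rowP => k; rewrite mxE.
    exact/eqP/negbNE.
  exists k; apply: (mulIf wk).
  by move/rowP/(_ k): e; rewrite mul_mx_diag !mxE mulrC => ->.
apply/eigenvalueP; exists (row k U).
  rewrite rowE /udiag !mulmxA -[_ *m U *m _]mulmxA unitary_mulV // mulmx1.
  rewrite -[_ *m _ *m U]mulmxA -!rowE; apply/rowP => j.
  by rewrite mxE mul_diag_mx !mxE.
apply/negP => /eqP r0; have := unitary_mulV uU.
move/matrixP/(_ k k); rewrite !mxE eqxx => /eqP; rewrite big1 => [|j _].
  by rewrite eq_sym oner_eq0.
by have /rowP/(_ j) := r0; rewrite !mxE => ->; rewrite mul0r.
Qed.

Lemma unitary_norm_le1 U i j : U \is unitarymx -> `|U i j| <= 1.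
Proof.
move=> uU; rewrite -(@ler_pXn2r _ 2) ?nnegrE // expr1n.
have /matrixP/(_ i i) := unitary_mulV uU; rewrite !mxE eqxx.
move=> e; rewrite [leRHS](_ : _ = true%:R) // -e (bigD1 j) //= !mxE -normCK.
rewrite lerDl sumr_ge0 // => k _.
by rewrite !mxE -normCK exprn_ge0.
Qed.

End unitary_diagonal.

HB.lock Definition retr {R : realType} {d : nat} (M : 'M[R[i]]_d) : R :=
  complex.Re (\tr M).

(** For Hermitian [A] the spectral entries are real, and the real part only changes their type. *)
Definition eigs {R : realType} {d : nat} (A : 'M[R[i]]_d) (k : 'I_d) : R :=
  complex.Re (spectral_diag A 0 k).

HB.lock Definition fcalc {R : realType} {d : nat} (f : R -> R)
    (A : 'M[R[i]]_d) : 'M[R[i]]_d :=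
  udiag (spectralmx A) (fun k => (f (eigs A k))%:C).

Section functional_calculus.
Context {R : realType} {d : nat}.
Implicit Types (A B M : 'M[R[i]]_d) (f g h : R -> R).

Lemma Re_sum I (r : seq I) (P : pred I) (F : I -> R[i]) :
  complex.Re (\sum_(k <- r | P k) F k) = \sum_(k <- r | P k) complex.Re (F k).
Proof. exact: (raddf_sum (@complex.Re R : Rcomplex R -> R)). Qed.

Lemma Im_sum I (r : seq I) (P : pred I) (F : I -> R[i]) :
  complex.Im (\sum_(k <- r | P k) F k) = \sum_(k <- r | P k) complex.Im (F k).
Proof. exact: (raddf_sum (@complex.Im R : Rcomplex R -> R)). Qed.

Lemma ReD (z w : R[i]) : complex.Re (z + w) = complex.Re z + complex.Re w.
Proof. by case: z w => ? ? []. Qed.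

Lemma ReN (z : R[i]) : complex.Re (- z) = - complex.Re z.
Proof. by case: z. Qed.

Lemma ReM (z w : R[i]) : complex.Re (z * w) =
  complex.Re z * complex.Re w - complex.Im z * complex.Im w.
Proof. by case: z w => ? ? []. Qed.

Lemma ImM (z w : R[i]) : complex.Im (z * w) =
  complex.Re z * complex.Im w + complex.Im z * complex.Re w.
Proof. by case: z w => ? ? []. Qed.

Lemma ImD (z w : R[i]) : complex.Im (z + w) = complex.Im z + complex.Im w.
Proof. by case: z w => ? ? []. Qed.

Lemma ImN (z : R[i]) : complex.Im (- z) = - complex.Im z.
Proof. by case: z. Qed.

Lemma ReZ (x : R) (z : R[i]) : complex.Re (x%:C * z) = x * complex.Re z.
Proof. by case: z => p q /=; rewrite mul0r subr0. Qed.

Lemma ImZ (x : R) (z : R[i]) : complex.Im (x%:C * z) = x * complex.Im z.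
Proof. by case: z => p q /=; rewrite mul0r addr0. Qed.

Lemma complexM (x y : R) : (x * y)%:C = x%:C * y%:C.
Proof. by rewrite rmorphM. Qed.

Lemma complexD (x y : R) : (x + y)%:C = x%:C + y%:C.
Proof. by rewrite rmorphD. Qed.

Lemma complexB (x y : R) : (x - y)%:C = x%:C - y%:C.
Proof. by rewrite rmorphB. Qed.

Lemma complexX (x : R) n : (x ^+ n)%:C = x%:C ^+ n.
Proof. by rewrite rmorphXn. Qed.

Lemma realC (x : R) : x%:C \is Num.real.
Proof. by rewrite complex_real. Qed.

Lemma complex_ge0 (z : R[i]) : 0 <= z -> z = (complex.Re z)%:C.
Proof. by case: z => p q; rewrite lecE /= => /andP[/eqP -> _]. Qed.

Lemma Re_ge0 (z : R[i]) : 0 <= z -> 0 <= complex.Re z.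
Proof. by case: z => p q; rewrite lecE /= => /andP[_]. Qed.

Lemma Re_sqr_norm_ge0 (z : R[i]) : 0 <= complex.Re (`|z| ^+ 2).
Proof. by apply: Re_ge0; rewrite exprn_ge0. Qed.

Lemma retrE M : retr M = complex.Re (\tr M).
Proof. by rewrite retr.unlock. Qed.

Lemma retrD A B : retr (A + B) = retr A + retr B.
Proof. by rewrite !retrE mxtraceD ReD. Qed.

Lemma retrN A : retr (- A) = - retr A.
Proof. by rewrite !retrE raddfN ReN. Qed.

Lemma retrB A B : retr (A - B) = retr A - retr B.
Proof. by rewrite retrD retrN. Qed.

Lemma retrZ (x : R) A : retr (x%:C *: A) = x * retr A.
Proof. by rewrite !retrE mxtraceZ ReZ. Qed.

Lemma fcalcE f A :
  fcalc f A = udiag (spectralmx A) (fun k => (f (eigs A k))%:C).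
Proof. by rewrite fcalc.unlock. Qed.

Lemma fcalc_id A : A \is hermsymmx -> fcalc id A = A.
Proof.
move=> hA; rewrite [RHS](hermitian_udiag hA) !fcalcE; congr (udiag _ _).
apply/funext => k; rewrite /eigs RRe_real //.
by have /mxOverP := hermitian_spectral_diag_real hA; apply.
Qed.

Lemma fcalc_herm f A : fcalc f A \is hermsymmx.
Proof. by rewrite fcalcE; apply: udiag_herm => k; exact: realC. Qed.

Lemma fcalcM f g A : fcalc f A *m fcalc g A = fcalc (fun x => f x * g x) A.
Proof.
rewrite !fcalcE (udiagM _ _ (spectral_unitarymx A)); congr (udiag _ _).
by apply/funext => k; rewrite complexM.
Qed.

Lemma fcalcD f g A : fcalc f A + fcalc g A = fcalc (fun x => f x + g x) A.
Proof.
rewrite !fcalcE udiagD; congr (udiag _ _).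
by apply/funext => k; rewrite complexD.
Qed.

Lemma fcalcZ (x : R) f A :
  fcalc (fun y => x * f y) A = x%:C *: fcalc f A.
Proof.
rewrite !fcalcE udiagZ; congr (udiag _ _).
by apply/funext => k; rewrite complexM.
Qed.

Lemma fcalc_cst (x : R) A : fcalc (fun=> x) A = x%:C%:M.
Proof. by rewrite fcalcE; exact: udiag_cst (spectral_unitarymx A). Qed.

(** The matrix [fcalc f A] has two diagonalizations, one in its own chosen eigenbasis and one in
    that of [A]; [udiag_map] shows that applying [g] does not depend on the choice. *)
Lemma fcalc_comp f g A : fcalc g (fcalc f A) = fcalc (g \o f) A.
Proof.
have := fcalc_id (fcalc_herm f A); move: (fcalc f A) (fcalcE f A) => B BE.
rewrite fcalcE => eB; have e := etrans eB BE; rewrite !fcalcE.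
exact: (udiag_map (fun z => (g (complex.Re z))%:C)
  (spectral_unitarymx _) (spectral_unitarymx _) e).
Qed.

Lemma fcalc_opp A : A \is hermsymmx -> fcalc -%R A = - A.
Proof.
move=> hA; apply/eqP; rewrite -addr_eq0 -[X in _ + X](fcalc_id hA) fcalcD.
rewrite [X in fcalc X](_ : _ = fun=> 0); last first.
  by apply/funext => x; rewrite addNr.
by rewrite fcalc_cst -[0%:C%:M]scalemx1 scale0r.
Qed.

Lemma hermsymmxN A :
  A \is hermsymmx -> - A \is hermsymmx.
Proof.
by move=> hA; rewrite -(fcalc_opp hA); exact: fcalc_herm.
Qed.

Lemma mul_fcalc f A : A \is hermsymmx ->
  A *m fcalc f A = fcalc (fun x => x * f x) A.
Proof. by move=> hA; rewrite -[X in X *m _](fcalc_id hA) fcalcM. Qed.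

Lemma retr_fcalc f A : retr (fcalc f A) = \sum_k f (eigs A k).
Proof.
rewrite -[fcalc f A]mul1mx retrE fcalcE mxtrace_mul_udiag Re_sum.
apply: eq_bigr => k _; rewrite mulmx1 (unitary_mulV (spectral_unitarymx A)).
by rewrite ReZ mxE eqxx mulr1.
Qed.

Lemma psd_diag_ge0 M (U : 'M[R[i]]_d) k : psd M -> 0 <= (U *m M *m U ^t*) k k.
Proof.
move=> [_ /(_ ((row k U) ^t*))]; rewrite trmxCK.
suff -> : (row k U *m M *m (row k U) ^t*) 0 0 = (U *m M *m U ^t*) k k by [].
rewrite -row_mul mxE [RHS]mxE; apply: eq_bigr => j _.
by rewrite [row k _ _ _]mxE; congr (_ * _); rewrite !mxE.
Qed.

(** In the eigenbasis of [A] the trace is a sum of values of [f] times diagonal entries of a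
    positive semidefinite matrix. This carries the Loewner bound on the conditional variance into
    the trace. *)
Lemma retr_mul_fcalc_ge0 M f A : psd M -> (forall x, 0 <= f x) ->
  0 <= retr (M *m fcalc f A).
Proof.
move=> psdM f_ge0; rewrite retrE fcalcE mxtrace_mul_udiag Re_sum.
apply: sumr_ge0 => k _; rewrite ReZ mulr_ge0 //; apply: Re_ge0.
exact: psd_diag_ge0.
Qed.

Lemma Re_sum2 (F : 'I_d -> 'I_d -> R) (w : 'I_d -> 'I_d -> R[i]) :
  complex.Re (\sum_k \sum_j (F j k)%:C * w j k) =
  \sum_k \sum_j F j k * complex.Re (w j k).
Proof.
rewrite Re_sum; apply: eq_bigr => k _.
by rewrite Re_sum; apply: eq_bigr => j _; rewrite ReZ.
Qed.

(* Expanding both sides in the eigenbases of [A] and [B] reduces this to the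
   scalar inequality, with nonnegative weights. *)
Lemma retr_mean_value A B h f : A \is hermsymmx -> B \is hermsymmx ->
  (forall x y, (x - y) * (h x - h y) <= (x - y) ^+ 2 * (f x + f y)) ->
  retr ((A - B) *m (fcalc h A - fcalc h B)) <=
  retr ((A - B) *m (A - B) *m (fcalc f A + fcalc f B)).
Proof.
move=> hA hB hf.
have uA := spectral_unitarymx A; have uB := spectral_unitarymx B.
pose w j k := `|(spectralmx A *m (spectralmx B) ^t*) j k| ^+ 2 : R[i].
have lhs : retr ((A - B) *m (fcalc h A - fcalc h B)) = \sum_k \sum_j
    ((eigs A j - eigs B k) * (h (eigs A j) - h (eigs B k))) *
    complex.Re (w j k).
  rewrite -[X in (X - _) *m _](fcalc_id hA) -[X in (_ - X) *m _](fcalc_id hB).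
  rewrite retrE !fcalcE (mxtrace_mulBB _ _ _ _ uA uB) -Re_sum2; apply: congr1.
  by apply: eq_bigr => k _; apply: eq_bigr => j _; rewrite complexM !complexB.
have rhs : retr ((A - B) *m (A - B) *m (fcalc f A + fcalc f B)) =
    \sum_k \sum_j ((eigs A j - eigs B k) ^+ 2 *
      (f (eigs A j) + f (eigs B k))) * complex.Re (w j k).
  rewrite [_ *m (_ + _)]mulmxDr retrD.
  have -> : A - B = fcalc id A - fcalc id B.
    by rewrite (fcalc_id hA) (fcalc_id hB).
  rewrite !retrE !fcalcE.
  rewrite (mxtrace_sqrB_mull _ _ _ uA uB) (mxtrace_sqrB_mulr _ _ _ uA uB).
  rewrite -ReD -Re_sum2; apply: congr1; rewrite -big_split.
  apply: eq_bigr => k _; rewrite -big_split; apply: eq_bigr => j _ /=.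
  by rewrite complexM complexD complexX complexB mulrDr mulrDl.
rewrite lhs rhs; apply: ler_sum => k _; apply: ler_sum => j _.
by apply: ler_wpM2r => //; exact: Re_sqr_norm_ge0.
Qed.

Lemma Re_norm (z : R[i]) : `|complex.Re z| <= complex.Re `|z|.
Proof. by have := normc_ge_Re z; rewrite lecE => /andP[]. Qed.

Lemma Im_norm (z : R[i]) : `|complex.Im z| <= complex.Re `|z|.
Proof.
case: z => p q; rewrite normc_def /= -sqrtr_sqr ler_wsqrtr // lerDr.
exact: sqr_ge0.
Qed.

Lemma norm_ReIm (z : R[i]) :
  complex.Re `|z| <= `|complex.Re z| + `|complex.Im z|.
Proof.
case: z => p q; rewrite normc_def /= -[leRHS]ger0_norm ?addr_ge0 // -sqrtr_sqr.
rewrite ler_wsqrtr // sqrrD !real_normK ?num_real // addrAC lerDl.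
by rewrite mulrn_wge0 // mulr_ge0.
Qed.

Lemma ReD_norm (z w : R[i]) :
  complex.Re `|z + w| <= complex.Re `|z| + complex.Re `|w|.
Proof. by have := ler_normD z w; rewrite lecE ReD => /andP[]. Qed.

Lemma Re_normM (z w : R[i]) :
  complex.Re `|z * w| = complex.Re `|z| * complex.Re `|w|.
Proof.
by rewrite normrM {1}(complex_ge0 (normr_ge0 z)) ReZ.
Qed.

Lemma Re_norm_sum I (r : seq I) (P : pred I) (F : I -> R[i]) :
  complex.Re `|\sum_(k <- r | P k) F k| <=
  \sum_(k <- r | P k) complex.Re `|F k|.
Proof.
elim/big_ind2: _ => [|x z y w xz yw|//]; first by rewrite normr0.
by rewrite (le_trans (ReD_norm _ _)) // lerD.
Qed.

Lemma Re_norm_unitary (U : 'M[R[i]]_d) i j : U \is unitarymx ->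
  complex.Re `|U i j| <= 1.
Proof.
by move=> uU; have := unitary_norm_le1 i j uU; rewrite lecE => /andP[].
Qed.

Lemma Re_norm_fcalc f A i j :
  complex.Re `|fcalc f A i j| <= \sum_k `|f (eigs A k)|.
Proof.
have uA := spectral_unitarymx A.
rewrite fcalcE udiagE (le_trans (Re_norm_sum _ _ _)) // ler_sum // => k _.
rewrite Re_normM Re_normM norm_conjC.
rewrite [X in X * _](_ : _ = `|f (eigs A k)|); last first.
  by rewrite normc_def /= expr0n addr0 sqrtr_sqr.
rewrite ler_piMr // mulr_ile1 ?Re_ge0 //; exact: Re_norm_unitary.
Qed.

(** An eigenvalue is a diagonal entry of [U A U^*], and the entries of [U] have modulus at most 1.
    Integrability of the entries of [X] thus yields that of its largest eigenvalue. *)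
Lemma eigs_le A k : A \is hermsymmx -> `|eigs A k| <=
  \sum_i \sum_j (`|complex.Re (A i j)| + `|complex.Im (A i j)|).
Proof.
move=> hA; have uA := spectral_unitarymx A.
have eA : (eigs A k)%:C =
    (spectralmx A *m A *m (spectralmx A) ^t*) k k.
  rewrite -[in X in _ *m X *m _](fcalc_id hA) !fcalcE /udiag.
  move: (spectralmx A) uA => U uU; rewrite !mulmxA (unitary_mulV uU) mul1mx.
  by rewrite -[_ *m U *m _]mulmxA (unitary_mulV uU) mulmx1 !mxE eqxx.
have -> : `|eigs A k| = complex.Re `|(eigs A k)%:C|.
  by rewrite normc_def /= expr0n addr0 sqrtr_sqr.
rewrite eA mxE (le_trans (Re_norm_sum _ _ _)) // exchange_big ler_sum //.
move=> j _; rewrite Re_normM.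
rewrite (@le_trans _ _ (complex.Re `|(spectralmx A *m A) k j|)) //.
  rewrite ler_piMr ?Re_ge0 // !mxE norm_conjC; exact: Re_norm_unitary.
rewrite mxE (le_trans (Re_norm_sum _ _ _)) // ler_sum // => i _.
rewrite Re_normM (le_trans _ (norm_ReIm _)) // ler_piMl ?Re_ge0 //.
exact: Re_norm_unitary.
Qed.

Lemma eigenvalueE A (x : R) : A \is hermsymmx ->
  eigenvalue A x%:C <-> exists k, eigs A k = x.
Proof.
move=> hA; rewrite -[in X in X <-> _](fcalc_id hA) !fcalcE.
rewrite (eigenvalue_udiag _ _ (spectral_unitarymx A)).
by split=> -[k e]; exists k; [exact: complexI e|rewrite e].
Qed.

Lemma lambda_minN A : lambda_min A = - lambda_max (- A).
Proof.
rewrite /lambda_min /lambda_max /inf; congr (- sup _).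
have eigN B (x : R) : eigenvalue B x%:C -> eigenvalue (- B) (- x)%:C.
  move=> /eigenvalueP[v vB v0]; apply/eigenvalueP; exists v => //.
  by rewrite mulmxN vB rmorphN scaleNr.
apply/seteqP; split=> x /=; first by move=> [y yA <-]; exact: eigN.
move=> /eigN; rewrite (opprK A) => xA; exists (- x) => //; exact: opprK.
Qed.

Lemma lambda_maxP A : (0 < d)%N -> A \is hermsymmx ->
  exists2 k, lambda_max A = eigs A k & forall j, eigs A j <= lambda_max A.
Proof.
move=> d_gt0 hA; pose k0 := Ordinal d_gt0.
pose k := [arg max_(k > k0) eigs A k]%O.
have k_max j : eigs A j <= eigs A k.
  by rewrite /k; case: arg_maxP => // m _; exact.
suff -> : lambda_max A = eigs A k by exists k.
apply/eqP; rewrite eq_le; apply/andP; split.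
  apply: ge_sup; first by exists (eigs A k); apply/(eigenvalueE _ hA); exists k.
  by move=> x /(eigenvalueE _ hA)[j <-].
apply: ub_le_sup; last by apply/(eigenvalueE _ hA); exists k.
by exists (eigs A k) => x /(eigenvalueE _ hA)[j <-].
Qed.

End functional_calculus.

(** * Measurability of spectral functions *)

Section measurable_functional_calculus.
Context {R : realType} {d : nat} {disp : measure_display}.
Context {S : measurableType disp}.
Implicit Types (F G : S -> 'M[R[i]]_d) (f g : R -> R).

Lemma mx_measurableD F G : mx_measurable F -> mx_measurable G ->
  mx_measurable (fun s => F s + G s).
Proof.
move=> mF mG i j; have [ReF ImF] := mF i j; have [ReG ImG] := mG i j; split.
  under eq_fun do rewrite mxE ReD; exact: measurable_funD.
by under eq_fun do rewrite mxE ImD; exact: measurable_funD.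
Qed.

Lemma mx_measurableM F G : mx_measurable F -> mx_measurable G ->
  mx_measurable (fun s => F s *m G s).
Proof.
move=> mF mG i j; split.
  under eq_fun do rewrite mxE Re_sum.
  apply: measurable_sum => k.
  have [ReF ImF] := mF i k; have [ReG ImG] := mG k j.
  under eq_fun do rewrite ReM.
  by apply: measurable_funB; exact: measurable_funM.
under eq_fun do rewrite mxE Im_sum.
apply: measurable_sum => k.
have [ReF ImF] := mF i k; have [ReG ImG] := mG k j.
under eq_fun do rewrite ImM.
by apply: measurable_funD; exact: measurable_funM.
Qed.

Lemma mx_measurableN F :
  mx_measurable F -> mx_measurable (fun s => - F s).
Proof.
move=> mF i j; have [mr mi] := mF i j; split.
  by under eq_fun do rewrite mxE ReN; exact: measurable_funN.
by under eq_fun do rewrite mxE ImN; exact: measurable_funN.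
Qed.

Lemma measurable_retr F : mx_measurable F ->
  measurable_fun setT (fun s => retr (F s)).
Proof.
move=> mF; under eq_fun do rewrite retrE /mxtrace Re_sum.
by apply: measurable_sum => k; have [] := mF k k.
Qed.

(** Nothing is known about the measurability of [spectralmx], so this class of functions is enlarged
    by algebraic operations, composition and limits until it contains the truncated exponential. *)
Definition fcalc_measurable f := forall F, mx_measurable F ->
  (forall s, F s \is hermsymmx) -> mx_measurable (fun s => fcalc f (F s)).

Lemma fcalc_measurable_id : fcalc_measurable id.
Proof. by move=> F mF hF; under eq_fun do rewrite fcalc_id //. Qed.

Lemma fcalc_measurable_cst (x : R) : fcalc_measurable (fun=> x).
Proof.
move=> F mF hF; under eq_fun do rewrite fcalc_cst.
by move=> i j; split; exact: measurable_cst.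
Qed.

Lemma fcalc_measurableD f g : fcalc_measurable f -> fcalc_measurable g ->
  fcalc_measurable (fun x => f x + g x).
Proof.
move=> mf mg F mF hF; under eq_fun do rewrite -fcalcD.
by apply: mx_measurableD; [exact: mf|exact: mg].
Qed.

Lemma fcalc_measurableM f g : fcalc_measurable f -> fcalc_measurable g ->
  fcalc_measurable (fun x => f x * g x).
Proof.
move=> mf mg F mF hF; under eq_fun do rewrite -fcalcM.
by apply: mx_measurableM; [exact: mf|exact: mg].
Qed.

Lemma fcalc_measurable_comp f g : fcalc_measurable f -> fcalc_measurable g ->
  fcalc_measurable (g \o f).
Proof.
move=> mf mg F mF hF; under eq_fun do rewrite -fcalc_comp.
by apply: mg => [|s]; [exact: mf|exact: fcalc_herm].
Qed.

Lemma Re_fcalcE f (A : 'M[R[i]]_d) i j : complex.Re (fcalc f A i j) =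
  \sum_k f (eigs A k) *
    complex.Re ((spectralmx A k i)^*%R * spectralmx A k j).
Proof. by rewrite fcalcE udiagE Re_sum; apply: eq_bigr => k _; rewrite ReZ. Qed.

Lemma Im_fcalcE f (A : 'M[R[i]]_d) i j : complex.Im (fcalc f A i j) =
  \sum_k f (eigs A k) *
    complex.Im ((spectralmx A k i)^*%R * spectralmx A k j).
Proof. by rewrite fcalcE udiagE Im_sum; apply: eq_bigr => k _; rewrite ImZ. Qed.

Lemma cvg_lincomb (a w : 'I_d -> R) (a_ : nat -> 'I_d -> R) :
  (forall k, a_ n k @[n --> \oo] --> a k) ->
  \sum_k a_ n k * w k @[n --> \oo] --> \sum_k a k * w k.
Proof.
move=> a_cvg; apply: cvg_big => [|k _].
  exact: add_continuous.
exact: cvgMl.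
Qed.

(** At a fixed sample point an entry of [fcalc (f_ n)] is a linear combination of the values of
    [f_ n] at the eigenvalues, with coefficients independent of [n]; pointwise convergence
    suffices. *)
Lemma fcalc_measurable_cvg f (f_ : nat -> R -> R) :
  (forall n, fcalc_measurable (f_ n)) ->
  (forall x, f_ n x @[n --> \oo] --> f x) -> fcalc_measurable f.
Proof.
move=> mf_ f_f F mF hF i j; split.
  apply: (@measurable_fun_cvg _ _ _ _
    (fun n s => complex.Re (fcalc (f_ n) (F s) i j))) => [n|s _].
    by have [] := mf_ n F mF hF i j.
  under eq_fun do rewrite Re_fcalcE; rewrite Re_fcalcE.
  by apply: cvg_lincomb => k; exact: f_f.
apply: (@measurable_fun_cvg _ _ _ _
  (fun n s => complex.Im (fcalc (f_ n) (F s) i j))) => [n|s _].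
  by have [] := mf_ n F mF hF i j.
under eq_fun do rewrite Im_fcalcE; rewrite Im_fcalcE.
by apply: cvg_lincomb => k; exact: f_f.
Qed.

Lemma fcalc_measurableX n : fcalc_measurable (fun x => x ^+ n).
Proof.
elim: n => [|n IHn].
  under eq_fun do rewrite expr0; exact: fcalc_measurable_cst.
under eq_fun do rewrite exprS.
by apply: fcalc_measurableM IHn; exact: fcalc_measurable_id.
Qed.

Lemma fcalc_measurable_expR : fcalc_measurable expR.
Proof.
apply: (@fcalc_measurable_cvg _ (fun n x => series (exp_coeff x) n)).
  move=> n; elim: n => [|n IHn].
    under eq_fun do rewrite /series /= big_nil.
    exact: fcalc_measurable_cst.
  under eq_fun do rewrite seriesSr.
  apply: fcalc_measurableD IHn _; apply: fcalc_measurableM.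
    exact: fcalc_measurableX.
  exact: fcalc_measurable_cst.
move=> x; exact: is_cvg_series_exp_coeff.
Qed.

Lemma fcalc_measurable_expR_comp f :
  fcalc_measurable f -> fcalc_measurable (fun x => expR (f x)).
Proof.
by move=> mf; apply: (fcalc_measurable_comp mf); exact: fcalc_measurable_expR.
Qed.

Lemma fcalc_measurableZ c f :
  fcalc_measurable f -> fcalc_measurable (fun x => c * f x).
Proof. by apply: fcalc_measurableM; exact: fcalc_measurable_cst. Qed.

(* The double exponential tends to the Heaviside function as [a] grows: this
   exhibits the positive part as a pointwise limit of functions built from
   polynomials and exponentials. *)
Lemma pos_part_expR_approx (x a : R) : 0 < a ->
  `|Num.max x 0 - x * expR (- expR (- (a * x)))| <= a^-1.
Proof.
move=> a0; have [x0|x0] := leP x 0.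
  rewrite sub0r normrN normrM ler0_norm // ger0_norm ?expR_ge0 //.
  rewrite expRN ler_pdivrMr ?expR_gt0 // -ler_pdivrMl ?invr_gt0 // invrK.
  rewrite mulrN -[- _ as X in X <= _]addr0.
  have := expR_ge1Dx (- (a * x)); have := expR_ge1Dx (expR (- (a * x))).
  by lra.
have := expR_ge1Dx (- expR (- (a * x))).
have := expR_ge1Dx (a * x); have ax : 0 < a * x by rewrite mulr_gt0.
rewrite expRN; set e := expR (a * x); set y := expR (- _) => e1 ye.
have e0 : 0 < e by exact: expR_gt0.
have y1 : y <= 1 by rewrite -expR0 ler_expR oppr_le0 invr_ge0 ltW.
rewrite -{1}[x]mulr1 -mulrBr ger0_norm; last first.
  by rewrite mulr_ge0 ?(ltW x0) // subr_ge0.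
rewrite (@le_trans _ _ (x * e^-1)) //.
  by rewrite ler_wpM2l ?(ltW x0) //; lra.
by rewrite ler_pdivrMr // ler_pdivlMl //; lra.
Qed.

Lemma fcalc_measurable_pos : fcalc_measurable (fun x => Num.max x 0).
Proof.
apply: (@fcalc_measurable_cvg _
  (fun n x => x * expR (- expR (- (n.+1%:R * x))))) => [n|x].
  apply: fcalc_measurableM; first exact: fcalc_measurable_id.
  apply: fcalc_measurable_expR_comp.
  under eq_fun do rewrite -mulN1r; apply: fcalc_measurableZ.
  apply: fcalc_measurable_expR_comp; under eq_fun do rewrite -mulNr.
  by apply: fcalc_measurableZ; exact: fcalc_measurable_id.
apply/cvgrPdist_le => e e0; near=> n.
rewrite (le_trans (pos_part_expR_approx _ _)) ?ltr0n //.
by apply: ltW; near: n; exact: near_infty_natSinv_lt (PosNum e0).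
Unshelve. all: by end_near. Qed.

Lemma fcalc_measurable_min (L : R) : fcalc_measurable (fun x => Num.min x L).
Proof.
rewrite [X in fcalc_measurable X](_ : _ =
  (fun x => x + -1 * Num.max (x + - L) 0)); last first.
  by apply/funext => x; case: leP => xL; case: leP => yL; lra.
apply: fcalc_measurableD; first exact: fcalc_measurable_id.
apply: fcalc_measurableZ.
apply: (@fcalc_measurable_comp (fun x => x + - L) (fun x => Num.max x 0)).
  apply: fcalc_measurableD; first exact: fcalc_measurable_id.
  exact: fcalc_measurable_cst.
exact: fcalc_measurable_pos.
Qed.

(** The largest eigenvalue exceeds [t] exactly when the trace of the positive part of [F - t] is
    positive, and that trace is already known to be measurable. *)
Lemma measurable_lambda_max F : (0 < d)%N -> mx_measurable F ->
  (forall s, F s \is hermsymmx) ->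
  measurable_fun setT (fun s => lambda_max (F s)).
Proof.
move=> d_gt0 mF hF.
have mpos t : measurable_fun setT
    (fun s => retr (fcalc (fun x => Num.max (x + - t) 0) (F s))).
  apply: measurable_retr.
  apply: (@fcalc_measurable_comp (fun x => x + - t) (fun x => Num.max x 0)) => //.
    apply: fcalc_measurableD; first exact: fcalc_measurable_id.
    exact: fcalc_measurable_cst.
  exact: fcalc_measurable_pos.
move=> mD; apply: (measurability _ (RGenOInfty.measurableE R)) => //.
move=> /= _ [_ [t ->] <-]; rewrite preimage_itvoy.
have := mpos t measurableT _ (measurable_itv `]0, +oo[).
rewrite preimage_itvoy; congr (measurable _); congr (_ `&` _).
apply/seteqP; split=> s /=; rewrite retr_fcalc.
  rewrite !ltNge; apply: contraNN => lt; rewrite big1 // => k _.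
  have [_ _ /(_ k) leF] := lambda_maxP d_gt0 (hF s).
  by apply/eqP; rewrite eq_le ge_max lexx le_max lexx orbT subr_le0 (le_trans leF).
have [k -> _] := lambda_maxP d_gt0 (hF s) => tk.
rewrite (bigD1 k) //= ltr_pwDl ?lt_max ?subr_gt0 ?tk // sumr_ge0 // => j _.
by rewrite le_max lexx orbT.
Qed.

End measurable_functional_calculus.

(** * Conditional expectations and exchangeable pairs *)

Section probability_facts.
Context {R : realType} {dO : measure_display} {Omega : measurableType dO}.
Variable P : probability Omega R.
Implicit Types (f g Y W : Omega -> R).

Definition Pint f := P.-integrable [set: Omega] (EFin \o f).

Definition Ex f : R := \int[P]_w f w.

Lemma PintD f g : Pint f -> Pint g -> Pint (fun w => f w + g w).
Proof. by move=> If Ig; apply: eq_integrable (integrableD _ If Ig). Qed.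

Lemma PintZ (c : R) f : Pint f -> Pint (fun w => c * f w).
Proof. by move=> If; apply: eq_integrable (integrableZl _ c If). Qed.

Lemma PintN f : Pint f -> Pint (fun w => - f w).
Proof. by move=> /(PintZ (-1)) If; under eq_fun do rewrite -mulN1r. Qed.

Lemma PintB f g : Pint f -> Pint g -> Pint (fun w => f w - g w).
Proof. by move=> If /PintN Ig; exact: PintD. Qed.

Lemma Pint_sum I (s : seq I) (F : I -> Omega -> R) :
  (forall i, Pint (F i)) -> Pint (fun w => \sum_(i <- s) F i w).
Proof.
move=> IF; elim: s => [|i s IHs].
  by under eq_fun do rewrite big_nil; exact: finite_measure_integrable_cst.
by under eq_fun do rewrite big_cons; exact: PintD.
Qed.

Lemma Pint_measurable f : Pint f -> measurable_fun setT f.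
Proof. by move=> /measurable_int/measurable_EFinP. Qed.

Lemma Pint_bounded (M : R) f : measurable_fun setT f -> (forall w, `|f w| <= M) ->
  Pint f.
Proof.
move=> mf fM; have IM := finite_measure_integrable_cst P `|M| measurableT.
apply: (le_integrable measurableT _ _ IM); first exact/measurable_EFinP.
by move=> w _; rewrite /= lee_fin normr_id (le_trans (fM w)) ?ler_norm.
Qed.

Lemma Pint_cst (c : R) : Pint (fun=> c).
Proof. exact: finite_measure_integrable_cst. Qed.

Lemma PintM_bounded (M : R) f g : Pint f -> measurable_fun setT g ->
  (forall w, `|g w| <= M) -> Pint (fun w => f w * g w).
Proof.
move=> If mg gM; apply: (le_integrable measurableT _ _ (PintZ M If)).
  by apply/measurable_EFinP/measurable_funM => //; exact: Pint_measurable.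
move=> w _; rewrite /= lee_fin !normrM mulrC ler_wpM2r //.
by rewrite (le_trans (gM w)) ?ler_norm.
Qed.

Lemma ExD f g : Pint f -> Pint g -> Ex (fun w => f w + g w) = Ex f + Ex g.
Proof. exact: RintegralD. Qed.

Lemma ExZ (c : R) f : Pint f -> Ex (fun w => c * f w) = c * Ex f.
Proof. exact: RintegralZl. Qed.

Lemma ExN f : Pint f -> Ex (fun w => - f w) = - Ex f.
Proof. by move=> If; under eq_fun do rewrite -mulN1r; rewrite ExZ // mulN1r. Qed.

Lemma ExB f g : Pint f -> Pint g -> Ex (fun w => f w - g w) = Ex f - Ex g.
Proof. exact: RintegralB. Qed.

Lemma Ex_cst (c : R) : Ex (fun=> c) = c.
Proof.
rewrite /Ex Rintegral_cst // -[X in _ * X]/(fine (P setT)).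
by rewrite probability_setT mulr1.
Qed.

Lemma Ex_sum I (s : seq I) (F : I -> Omega -> R) : (forall i, Pint (F i)) ->
  Ex (fun w => \sum_(i <- s) F i w) = \sum_(i <- s) Ex (F i).
Proof.
move=> IF; elim: s => [|i s IHs].
  by rewrite big_nil; under eq_fun do rewrite big_nil; rewrite Ex_cst.
rewrite big_cons -IHs -ExD //; last exact: Pint_sum.
by congr Ex; apply/funext => w; rewrite big_cons.
Qed.

Lemma le_Ex f g : Pint f -> Pint g -> (forall w, f w <= g w) -> Ex f <= Ex g.
Proof. by move=> If Ig fg; exact: le_Rintegral. Qed.

Lemma EFin_Ex f : Pint f -> ((Ex f)%:E = 'E_P[f])%E.
Proof. by move=> If; rewrite unlock fineK //; exact: integrable_fin_num. Qed.

(** Replacing [g] by [max(f, g)] changes it on a null set only and makes the comparison hold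
    everywhere. *)
Lemma ae_le_Ex f g : Pint f -> Pint g -> {ae P, forall w, f w <= g w} ->
  Ex f <= Ex g.
Proof.
move=> If Ig fg.
pose g' := f \max g.
have mf := Pint_measurable If; have mg := Pint_measurable Ig.
have Ig' : Pint g'.
  have IfIg := PintD (integrable_norm If) (integrable_norm Ig).
  apply: (le_integrable measurableT _ _ IfIg).
    by apply/measurable_EFinP; exact: measurable_maxr.
  move=> w _; rewrite /= lee_fin [leRHS]ger0_norm ?addr_ge0 // /g' /Order.max_fun.
  by rewrite maxEle; case: ifP; rewrite ?lerDl ?lerDr.
have -> : Ex g = Ex g'.
  congr fine; apply: ae_eq_integral => //.
  - exact/measurable_EFinP.
  - exact: measurable_int Ig'.
  - by apply: filterS fg => w fgw _ /=; rewrite /g' /Order.max_fun max_r.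
by apply: le_Ex => // w; rewrite /g' /Order.max_fun le_max lexx.
Qed.

Lemma Ex_norm_le f : Pint f -> `|Ex f| <= Ex (fun w => `|f w|).
Proof. exact: le_normr_Rintegral. Qed.

Lemma Ex_ge0 f : (forall w, 0 <= f w) -> 0 <= Ex f.
Proof. by move=> f0; exact: Rintegral_ge0. Qed.

Lemma Ex_mul_indic f (B : set Omega) : measurable B ->
  Ex (fun w => f w * \1_B w) = fine (\int[P]_(w in B) (f w)%:E)%E.
Proof.
move=> mB; rewrite -[RHS]/(Rintegral P B f) Rintegral_mkcond; congr fine.
apply: eq_integral => w _; rewrite patchE indicE.
by case: ifP; rewrite ?mulr1 ?mulr0.
Qed.

(** The sum counts the integers of [[1, N]] below [y]: up to the cap [N] it is the integer part of
    [y]. *)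
Lemma sum_nat_le_approx (y : R) N : 0 <= y ->
  let S := \sum_(k < N) (k.+1%:R <= y)%R%:R in
  (N%:R <= y -> S = N%:R) /\ (y <= N%:R -> y - 1 <= S <= y).
Proof.
move=> y0 /=; elim: N => [|N [IH1 IH2]].
  by rewrite big_ord0; split=> // y1; apply/andP; lra.
rewrite big_ord_recr /=; have [yN|yN] := leP N.+1%:R y.
  have NN : N%:R <= N.+1%:R :> R by rewrite ler_nat.
  rewrite (IH1 (le_trans NN yN)) [_ + _]natr1; split=> [//|y1].
  by apply/andP; lra.
rewrite addr0; split=> [//|_].
have [Ny|/ltW] := leP N%:R y; last exact: IH2.
by rewrite IH1 //; move: yN; rewrite -natr1 => ?; apply/andP; lra.
Qed.

Section cond_exp.
Context {dT : measure_display} {T : measurableType dT}.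
Variables (Z : Omega -> T) (Y W : Omega -> R).
Hypothesis mZ : measurable_fun setT Z.
Hypothesis YW : is_cond_exp P Z Y W.

Lemma cond_exp_indic (B : set T) : measurable B ->
  Ex (fun w => (Y w - W w) * \1_B (Z w)) = 0.
Proof.
move=> mB; have [IY IW _ e] := YW.
have mZB : measurable (Z @^-1` B) by rewrite -[_ @^-1` _]setTI; exact: mZ.
have -> : (fun w => (Y w - W w) * \1_B (Z w)) =
    (fun w => Y w * \1_(Z @^-1` B) w - W w * \1_(Z @^-1` B) w).
  by apply/funext => w; rewrite -mulrBl !indicE; congr (_ * _).
have bnd w : `|\1_(Z @^-1` B) w| <= (1 : R).
  by rewrite indicE ger0_norm ?ler0n //; case: (_ \in _).
rewrite ExB ?Ex_mul_indic // ?e ?subrr //.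
  by apply: (PintM_bounded IY _ bnd); exact: measurable_indic.
by apply: (PintM_bounded IW _ bnd); exact: measurable_indic.
Qed.

(* [n (g + M)] is within 1 of a sum of indicators, each of which integrates to
   zero against [Y - W], so that [|E (Y - W) g(Z)| <= E |Y - W| / n]. *)
Lemma cond_exp_bounded (M : R) (g : T -> R) : measurable_fun setT g ->
  (forall z, `|g z| <= M) ->
  Ex (fun w => Y w * g (Z w)) = Ex (fun w => W w * g (Z w)).
Proof.
move=> mg gM; have [IY IW _ _] := YW.
have mgZ : measurable_fun setT (g \o Z) by exact: measurableT_comp mg mZ.
have ID : Pint (fun w => Y w - W w) by exact: PintB.
apply/eqP; rewrite -subr_eq0 -ExB; first last.
- exact: (PintM_bounded IW mgZ (fun w => gM _)).
- exact: (PintM_bounded IY mgZ (fun w => gM _)).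
have M0 : 0 <= M by exact: le_trans (normr_ge0 _) (gM point).
set D := fun w => _; have {D} -> : D = fun w => (Y w - W w) * g (Z w).
  by apply/funext => w; rewrite /D mulrBl.
pose K := Ex (fun w => `|Y w - W w|).
rewrite -normr_le0; apply/ler_addgt0Pr => e e0; rewrite add0r.
(* The mesh [1 / n] is fine enough for the rounding error [K / n] to be at most [e]. *)
pose n := (Num.trunc (K / e)).+1; have n0 : 0 < n%:R :> R by rewrite ltr0n.
have Kn : K <= e * n%:R.
  rewrite mulrC -ler_pdivrMr // ltW //; exact: truncnS_gt.
(* [N] exceeds every value of [n (g + M)], so the count is never capped. *)
pose N := (Num.trunc (n%:R * (M + M))).+1.
pose B k := [set z | k.+1%:R <= n%:R * (g z + M)].
have mB k : measurable (B k).
  rewrite -[B k]setTI; apply: measurable_fun_le => //.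
  by apply: measurable_funM => //; exact: measurable_funD.
have appr z : `|n%:R * (g z + M) - \sum_(k < N) \1_(B k) z| <= 1.
  have gz : 0 <= n%:R * (g z + M).
    apply: mulr_ge0; first exact: ltW.
    by have := gM z; rewrite ler_norml => /andP[]; rewrite -subr_ge0 opprK.
  have := (sum_nat_le_approx N gz).2.
  have -> : \sum_(k < N) \1_(B k) z =
      \sum_(k < N) (k.+1%:R <= n%:R * (g z + M))%R%:R :> R.
    apply: eq_bigr => k _; rewrite indicE; congr (nat_of_bool _)%:R.
    by apply/idP/idP; rewrite inE.
  have gN : n%:R * (g z + M) <= N%:R.
    apply: (@le_trans _ _ (n%:R * (M + M))); last first.
      by apply/ltW; exact: truncnS_gt.
    apply: ler_wpM2l; first exact: ltW.
    by rewrite lerD2r (le_trans (ler_norm _)).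
  by move=> /(_ gN) /andP[? ?]; rewrite ler_norml; apply/andP; lra.
have m1 k : measurable_fun setT (fun w => \1_(B k) (Z w) : R).
  by apply: measurableT_comp mZ; exact: measurable_indic.
have Dind k : Pint (fun w => (Y w - W w) * \1_(B k) (Z w)).
  apply: (PintM_bounded (M := 1) ID) => // w.
  by rewrite indicE ger0_norm ?ler0n //; case: (_ \in _).
have Dg : Pint (fun w => (Y w - W w) * g (Z w)).
  exact: (PintM_bounded ID mgZ (fun w => gM _)).
have ED0 : Ex (fun w => Y w - W w) = 0.
  rewrite -(cond_exp_indic measurableT); congr Ex; apply/funext => w.
  by rewrite indicT mulr1.
pose S w := \sum_(k < N) (Y w - W w) * \1_(B k) (Z w).
have ES : Ex S = 0.
  by rewrite Ex_sum // big1 // => k _; exact: cond_exp_indic.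
(* [Q] is [Y - W] times the rounding error, hence at most [|Y - W|] in absolute value; its last two
   terms have mean zero. *)
pose Q w := n%:R * ((Y w - W w) * g (Z w)) + (n%:R * M) * (Y w - W w) - S w.
have IQ : Pint Q.
  by apply: PintB; [apply: PintD; exact: PintZ|exact: Pint_sum].
have EQ : Ex Q = n%:R * Ex (fun w => (Y w - W w) * g (Z w)).
  rewrite /Q ExB ?ExD ?ExZ ?ED0 ?ES ?mulr0 ?addr0 ?subr0 //.
  - exact: PintZ.
  - exact: PintZ.
  - by apply: PintD; exact: PintZ.
  - exact: Pint_sum.
have : `|Ex Q| <= K.
  rewrite (le_trans (Ex_norm_le IQ)) // le_Ex //; try exact: integrable_norm.
  move=> w; have -> : Q w =
      (Y w - W w) * (n%:R * (g (Z w) + M) - \sum_(k < N) \1_(B k) (Z w)).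
    by rewrite /Q /S -mulr_sumr; ring.
  by rewrite normrM ler_piMr.
rewrite EQ normrM gtr0_norm // => /le_trans /(_ Kn).
by rewrite mulrC ler_pM2r.
Qed.

End cond_exp.

Section exchangeable.
Context {dT : measure_display} {T : measurableType dT}.
Variables (Z Z' : Omega -> T).
Hypothesis mZ : measurable_fun setT Z.
Hypothesis mZ' : measurable_fun setT Z'.
Hypothesis ZZ' : forall B : set (T * T), measurable B ->
  pushforward P (fun w => (Z w, Z' w)) B =
  pushforward P (fun w => (Z' w, Z w)) B.

Lemma Ex_exchange (F : T * T -> R) : measurable_fun setT F ->
  Pint (fun w => F (Z w, Z' w)) ->
  Pint (fun w => F (Z' w, Z w)) /\
  Ex (fun w => F (Z' w, Z w)) = Ex (fun w => F (Z w, Z' w)).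
Proof.
move=> mF IF.
have m1 : measurable_fun setT (fun w => (Z w, Z' w)).
  exact: measurable_fun_pair.
have m2 : measurable_fun setT (fun w => (Z' w, Z w)).
  exact: measurable_fun_pair.
have mEF : measurable_fun setT (EFin \o F) by exact/measurable_EFinP.
have eqint (f : T * T -> \bar R) :
    (\int[pushforward P (fun w => (Z w, Z' w))]_x f x =
     \int[pushforward P (fun w => (Z' w, Z w))]_x f x)%E.
  by apply: eq_measure_integral => B mB _; exact: ZZ'.
have IF' : Pint (fun w => F (Z' w, Z w)).
  apply/integrableP; split.
    by apply/measurable_EFinP; exact: measurableT_comp mF m2.
  have /integrableP[_] := IF.
  have := eqint (fun x => `|(F x)%:E|%E).
  rewrite !ge0_integral_pushforward //; last 2 first.
    exact: measurableT_comp.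
    exact: measurableT_comp.
  by rewrite !preimage_setT => ->.
split=> //; congr fine; have := eqint (EFin \o F).
by rewrite !integral_pushforward // !preimage_setT => ->.
Qed.

Lemma Ex_symmetrize (F : T * T -> R) : measurable_fun setT F ->
  Pint (fun w => F (Z w, Z' w)) ->
  Pint (fun w => F (Z w, Z' w) + F (Z' w, Z w)) /\
  Ex (fun w => F (Z w, Z' w) + F (Z' w, Z w)) = 2 * Ex (fun w => F (Z w, Z' w)).
Proof.
move=> mF IF; have [IF' EF] := Ex_exchange mF IF.
split; first exact: PintD.
by rewrite ExD // EF mulr_natl mulr2n.
Qed.

(** The pointwise inequality is available only after symmetrizing in the two variables; by
    exchangeability this merely doubles both expectations. *)
Lemma Ex_exchange_le (a : R) (F G : T * T -> R) :
  measurable_fun setT F -> measurable_fun setT G ->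
  Pint (fun w => F (Z w, Z' w)) -> Pint (fun w => G (Z w, Z' w)) ->
  (forall z z', F (z, z') + F (z', z) <= a * (G (z, z') + G (z', z))) ->
  Ex (fun w => F (Z w, Z' w)) <= a * Ex (fun w => G (Z w, Z' w)).
Proof.
move=> mF mG IF IG FG.
have [IF2 EF] := Ex_symmetrize mF IF; have [IG2 EG] := Ex_symmetrize mG IG.
rewrite -(@ler_pM2l _ 2) // mulrCA -EF -EG -ExZ //.
by apply: le_Ex => //; exact: PintZ.
Qed.

End exchangeable.

End probability_facts.

(** * Truncated exponentials *)

HB.lock Definition trunc_exp {R : realType} (theta L x : R) : R :=
  expR (theta * Num.min x L).

Section scalar.
Context {R : realType}.
Implicit Types (x y s t c v theta L : R).

Lemma is_derive_ge0_le (f df : R -> R) y :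
  (forall x, is_derive x 1 f (df x)) -> (forall x, 0 <= x -> 0 <= df x) ->
  0 <= y -> f 0 <= f y.
Proof.
move=> fdf df0 y0.
have der x : derivable f x 1 by case: (fdf x).
have [c cy fc] := MVT_segment y0 (fun x _ => fdf x)
  (derivable_within_continuous (fun x _ => der x)).
move: cy; rewrite in_itv /= => /andP[c0 _].
by rewrite -subr_ge0 fc subr0; apply: mulr_ge0; [exact: df0|exact: y0].
Qed.

(** The trapezoid rule overestimates the integral of [exp] over [[0, y]]. The difference of the two
    sides vanishes at 0 and is nondecreasing, because [1 - x <= exp(- x)]. *)
Lemma expR_trapezoid_ge0 y : 0 <= y -> 2 * (expR y - 1) <= y * (expR y + 1).
Proof.
move=> y0; rewrite -subr_ge0.
pose f := fun y => y * (expR y + 1) - 2 * (expR y - 1).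
pose df := fun y => (expR y + 1 + y * expR y) - 2 * expR y.
have fdf x : is_derive x 1 f (df x).
  by apply: is_derive_eq; rewrite /df /GRing.scale /=; ring.
have -> : 0 = f 0 by rewrite /f expR0; ring.
apply: (is_derive_ge0_le fdf) => // x x0; rewrite /df.
have := expR_ge1Dx (- x); rewrite expRN.
have e0 := expR_gt0 x; rewrite -(ler_pM2r e0) mulVf ?gt_eqF //; lra.
Qed.

Lemma expR_trapezoid x y : y <= x ->
  2 * (expR x - expR y) <= (x - y) * (expR x + expR y).
Proof.
move=> yx; have := @expR_trapezoid_ge0 (x - y); rewrite subr_ge0 => /(_ yx).
rewrite expRB; have e0 := expR_gt0 y; rewrite -(ler_pM2r e0).
set a := expR x; set b := expR y.
have -> : 2 * (a / b - 1) * b = 2 * (a - b) by field; rewrite gt_eqF.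
by have -> : (x - y) * (a / b + 1) * b = (x - y) * (a + b) by field; rewrite gt_eqF.
Qed.

Lemma sinh_ge y : 0 <= y -> 2 * y <= expR y - expR (- y).
Proof.
move=> y0; rewrite -subr_ge0.
pose f := fun y => expR y - expR (- y) - 2 * y.
pose df := fun y => expR y + expR (- y) - 2.
have fdf x : is_derive x 1 f (df x).
  by apply: is_derive_eq; rewrite /df /GRing.scale /=; ring.
have -> : 0 = f 0 by rewrite /f oppr0 expR0; ring.
apply: (is_derive_ge0_le fdf) => // x x0; rewrite /df.
by have := expR_ge1Dx (- x); have := expR_ge1Dx x; lra.
Qed.

(** This is [y <= sinh y] at [y = ln s]. It is the estimate that turns logarithmic rates into
    Bernstein rates. *)
Lemma ln_le_half s : 1 <= s -> ln s <= (s - s^-1) / 2.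
Proof.
move=> s1; have s0 : 0 < s by lra.
have := @sinh_ge (ln s); rewrite ln_ge0 // => /(_ isT).
by rewrite expRN lnK ?posrE //; lra.
Qed.

Lemma trunc_expE theta L x : trunc_exp theta L x = expR (theta * Num.min x L).
Proof. by rewrite trunc_exp.unlock. Qed.

Lemma trunc_exp_ge0 theta L x : 0 <= trunc_exp theta L x.
Proof. by rewrite trunc_expE expR_ge0. Qed.

Lemma trunc_exp_le theta L x : 0 <= theta ->
  trunc_exp theta L x <= expR (theta * L).
Proof.
by move=> th0; rewrite trunc_expE ler_expR ler_wpM2l // ge_min lexx orbT.
Qed.

(** For [y <= x], the trapezoid inequality at the truncated points bounds the increment of the
    exponential; as truncation is 1-Lipschitz, the truncated gap is then replaced by [x - y]. *)
Lemma trunc_exp_mean_value theta L x y : 0 <= theta ->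
  (x - y) * (trunc_exp theta L x - trunc_exp theta L y) <=
  (x - y) ^+ 2 *
    (theta / 2 * trunc_exp theta L x + theta / 2 * trunc_exp theta L y).
Proof.
move=> th0; wlog yx : x y / y <= x.
  move=> H; have [/H//|/ltW/H] := leP y x.
  by rewrite -sqrrN; lra.
have mono : Num.min y L <= Num.min x L by rewrite le_min !ge_min yx lexx orbT.
have lip : Num.min x L - Num.min y L <= x - y.
  by case: (leP x L) => ?; case: (leP y L) => ?; lra.
have := @expR_trapezoid (theta * Num.min x L) (theta * Num.min y L).
rewrite ler_wpM2l // => /(_ isT).
rewrite -!trunc_expE -mulrBr.
have hx := trunc_exp_ge0 theta L x; have hy := trunc_exp_ge0 theta L y.
move: (trunc_exp theta L x) (trunc_exp theta L y) hx hy => p q p0 q0.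
rewrite -[_ * _ * (p + q)]mulrA mulrCA => pq.
have xy0 : 0 <= x - y by rewrite subr_ge0.
have : (Num.min x L - Num.min y L) * (theta * (p + q)) <=
    (x - y) * (theta * (p + q)).
  by rewrite ler_wpM2r // mulr_ge0 // addr_ge0.
move=> /(le_trans pq) pq'; rewrite expr2 -mulrA ler_wpM2l //; lra.
Qed.

(** The factor [exp(- (theta' - theta) (min(x, L) - g))] is bounded below by its tangent, and
    [min(x, L) <= x] then puts the untruncated [x] in the linear term. The free parameter [g] will
    bound the logarithmic derivative of [m] at [theta']. *)
Lemma trunc_exp_tangent theta theta' g L x : theta <= theta' ->
  expR (- (theta' - theta) * g) *
    (trunc_exp theta' L x -
     (theta' - theta) * (x * trunc_exp theta' L x - g * trunc_exp theta' L x)) <=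
  trunc_exp theta L x.
Proof.
rewrite -subr_ge0 !trunc_expE; set m := Num.min x L; set dl := theta' - theta.
move=> dl0; have mx : m <= x by rewrite ge_min lexx.
have -> : theta * m = - dl * g + theta' * m + (- (dl * (m - g))).
  by rewrite /dl; ring.
rewrite expRD expRD -[leRHS]mulrA ler_wpM2l ?expR_ge0 //.
rewrite -mulrBl mulrA -[X in X - _]mul1r -mulrBl mulrC ler_wpM2l ?expR_ge0 //.
apply: le_trans (expR_ge1Dx _); rewrite lerD2l lerN2 ler_wpM2l //.
by rewrite lerD2r.
Qed.

(* Each step of a uniform subdivision costs [g] at its right end while [G] is
   controlled by [g] at the left end; the discrepancy telescopes to
   [(tau / n) * (g tau - g 0)]. *)
Lemma discrete_gronwall (m g G : R -> R) tau : 0 <= tau ->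
  (forall x, 0 <= x <= tau -> 0 <= m x) ->
  (forall x y, 0 <= x -> x <= y -> y <= tau -> m y <= expR ((y - x) * g y) * m x) ->
  (forall x y, 0 <= x -> x <= y -> y <= tau -> (y - x) * g x <= G y - G x) ->
  m tau <= expR (G tau - G 0) * m 0.
Proof.
move=> tau0 m0 mg gG.
pose C := tau * (g tau - g 0).
have key n : m tau <= expR (G tau - G 0 + C / n.+1%:R) * m 0.
  pose dl := tau / n.+1%:R.
  have n0 : 0 < n.+1%:R :> R by rewrite ltr0n.
  have dl0 : 0 <= dl by rewrite divr_ge0 // ltW.
  have dltau : n.+1%:R * dl = tau by rewrite /dl mulrC divfK // gt_eqF.
  have step k : (k <= n.+1)%N -> m (k%:R * dl) <=
      expR (G (k%:R * dl) - G 0 + dl * (g (k%:R * dl) - g 0)) * m 0.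
    elim: k => [_|k IHk kn]; first by rewrite mul0r !subrr mulr0 addr0 expR0 mul1r.
    have x0 : 0 <= k%:R * dl by rewrite mulr_ge0.
    have xy : k%:R * dl <= k.+1%:R * dl by rewrite ler_wpM2r // ler_nat.
    have yt : k.+1%:R * dl <= tau by rewrite -dltau ler_wpM2r // ler_nat.
    have yx : k.+1%:R * dl - k%:R * dl = dl by rewrite -natr1; ring.
    have := mg _ _ x0 xy yt; have := gG _ _ x0 xy yt; rewrite yx.
    move: (k%:R * dl) (k.+1%:R * dl) (IHk (ltnW kn)) x0 xy yt {yx}.
    move=> x y mx x0 xy yt gGxy mgxy.
    apply: (le_trans mgxy); apply: (@le_trans _ _ (expR (dl * g y) *
      (expR (G x - G 0 + dl * (g x - g 0)) * m 0))).
      by rewrite ler_wpM2l ?expR_ge0.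
    rewrite mulrA -expRD ler_wpM2r ?m0 ?lexx //.
    by rewrite ler_expR; lra.
  have := step n.+1 (leqnn _); rewrite dltau.
  by congr (_ <= expR (_ + _) * _); rewrite /C /dl; ring.
have cvgn : expR (G tau - G 0 + C / n.+1%:R) * m 0 @[n --> \oo] -->
    expR (G tau - G 0 + C * 0) * m 0.
  apply: cvgMl; apply: continuous_cvg; first exact: continuous_expR.
  apply: cvgD; first exact: cvg_cst.
  apply: cvgMr; exact: cvg_harmonic.
rewrite mulr0 addr0 in cvgn.
rewrite -(cvg_lim _ cvgn) //; apply: limr_ge; first exact: cvgP cvgn.
exact: nearW.
Qed.

End scalar.

(** * The trace inequality for matrix Stein pairs *)

Section matrix_expectation.
Context {R : realType} {dO : measure_display} {Omega : measurableType dO}.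
Variable P : probability Omega R.
Context {dT : measure_display} {T : measurableType dT} {d : nat}.

Lemma retr_mulE (A B : 'M[R[i]]_d) : retr (A *m B) = \sum_i \sum_j
  (complex.Re (A i j) * complex.Re (B j i) -
   complex.Im (A i j) * complex.Im (B j i)).
Proof.
rewrite retrE /mxtrace Re_sum; apply: eq_bigr => i _; rewrite mxE Re_sum.
by apply: eq_bigr => j _; rewrite ReM.
Qed.

Definition mx_bounded (K : R) (G : T -> 'M[R[i]]_d) : Prop :=
  forall z i j, `|complex.Re (G z i j)| <= K /\ `|complex.Im (G z i j)| <= K.

Lemma mx_cond_exp_retr (Z : Omega -> T) (Y W : Omega -> 'M[R[i]]_d)
    (G : T -> 'M[R[i]]_d) (K : R) :
  measurable_fun setT Z -> is_mx_cond_exp P Z Y W ->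
  mx_measurable G -> mx_bounded K G ->
  [/\ Pint P (fun w => retr (Y w *m G (Z w))),
      Pint P (fun w => retr (W w *m G (Z w))) &
      Ex P (fun w => retr (Y w *m G (Z w))) =
      Ex P (fun w => retr (W w *m G (Z w)))].
Proof.
move=> mZ YW mG GK.
have mReG i j : measurable_fun setT (fun w => complex.Re (G (Z w) i j)).
  exact: (measurableT_comp (mG i j).1 mZ).
have mImG i j : measurable_fun setT (fun w => complex.Im (G (Z w) i j)).
  exact: (measurableT_comp (mG i j).2 mZ).
have IRe (V : Omega -> 'M[R[i]]_d) i j : Pint P (fun w => complex.Re (V w i j)) ->
    Pint P (fun w => complex.Re (V w i j) * complex.Re (G (Z w) j i)).
  by move=> IV; apply: (PintM_bounded IV (mReG _ _) (fun w => (GK (Z w) j i).1)).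
have IIm (V : Omega -> 'M[R[i]]_d) i j : Pint P (fun w => complex.Im (V w i j)) ->
    Pint P (fun w => complex.Im (V w i j) * complex.Im (G (Z w) j i)).
  by move=> IV; apply: (PintM_bounded IV (mImG _ _) (fun w => (GK (Z w) j i).2)).
have I (V : Omega -> 'M[R[i]]_d) : (forall i j,
    Pint P (fun w => complex.Re (V w i j)) /\
    Pint P (fun w => complex.Im (V w i j))) ->
    Pint P (fun w => retr (V w *m G (Z w))) /\
    Ex P (fun w => retr (V w *m G (Z w))) = \sum_i \sum_j
      (Ex P (fun w => complex.Re (V w i j) * complex.Re (G (Z w) j i)) -
       Ex P (fun w => complex.Im (V w i j) * complex.Im (G (Z w) j i))).
  move=> IV.
  have Iij i j : Pint P (fun w => complex.Re (V w i j) * complex.Re (G (Z w) j i) -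
       complex.Im (V w i j) * complex.Im (G (Z w) j i)).
    by apply: PintB; [apply: IRe|apply: IIm]; have [] := IV i j.
  split; first by under eq_fun do rewrite retr_mulE; do 2 apply: Pint_sum => ?.
  under eq_fun do rewrite retr_mulE; rewrite Ex_sum => [|i]; last exact: Pint_sum.
  apply: eq_bigr => i _; rewrite Ex_sum //; apply: eq_bigr => j _.
  by rewrite ExB //; [apply: IRe|apply: IIm]; have [] := IV i j.
have [|IY EY] := I Y; first by move=> i j; have [[? _ _ _] [? _ _ _]] := YW i j.
have [|IW EW] := I W; first by move=> i j; have [[_ ? _ _] [_ ? _ _]] := YW i j.
split; [exact: IY|exact: IW|].
rewrite EY EW; apply: eq_bigr => i _; apply: eq_bigr => j _.
have [YWr YWi] := YW i j; have [mr mi] := mG j i; congr (_ - _).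
  exact: (cond_exp_bounded mZ YWr mr (fun z => (GK z j i).1)).
exact: (cond_exp_bounded mZ YWi mi (fun z => (GK z j i).2)).
Qed.

Lemma mx_cond_expN (Z : Omega -> T) (Y W : Omega -> 'M[R[i]]_d) :
  measurable_fun setT Z ->
  is_mx_cond_exp P Z Y W -> is_mx_cond_exp P Z (fun w => - Y w) (fun w => - W w).
Proof.
move=> mZ.
have cN (f g : Omega -> R) : is_cond_exp P Z f g ->
    is_cond_exp P Z (fun w => - f w) (fun w => - g w).
  move=> [If Ig mg e]; split; [exact: PintN|exact: PintN| |].
    exact: measurable_funN.
  move=> B mB.
  have mZB : measurable (Z @^-1` B) by rewrite -[_ @^-1` _]setTI; exact: mZ.
  under eq_integral do rewrite EFinN.
  under [RHS]eq_integral do rewrite EFinN.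
  have Ifs := integrableS measurableT mZB (@subsetT _ _) If.
  have Igs := integrableS measurableT mZB (@subsetT _ _) Ig.
  rewrite integralN; last exact: integrable_add_def Igs.
  by rewrite integralN ?e //; exact: integrable_add_def Ifs.
move=> YW i j; have [YWr YWi] := YW i j; split.
  under eq_fun do rewrite mxE ReN.
  by under [X in is_cond_exp _ _ _ X]eq_fun do rewrite mxE ReN; exact: cN.
under eq_fun do rewrite mxE ImN.
by under [X in is_cond_exp _ _ _ X]eq_fun do rewrite mxE ImN; exact: cN.
Qed.

End matrix_expectation.

Section stein.
Context {R : realType} {dO : measure_display} {Omega : measurableType dO}.
Variable P : probability Omega R.
Context {dT : measure_display} {T : measurableType dT} {d : nat}.
Variables (Z Z' : Omega -> T) (Psi : T -> 'M[R[i]]_d) (V : Omega -> 'M[R[i]]_d).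
Variables (alpha c v : R).
Hypothesis mZ : measurable_fun setT Z.
Hypothesis mZ' : measurable_fun setT Z'.
Hypothesis exchZ : forall B : set (T * T), measurable B ->
  pushforward P (fun w => (Z w, Z' w)) B =
  pushforward P (fun w => (Z' w, Z w)) B.
Hypothesis mPsi : mx_measurable Psi.
Hypothesis hPsi : forall z, Psi z \is hermsymmx.
Hypothesis alpha_gt0 : 0 < alpha.
Let X w := Psi (Z w).
Let X' w := Psi (Z' w).
Hypothesis stein :
  is_mx_cond_exp P Z (fun w => X w - X' w) (fun w => alpha%:C *: X w).
Hypothesis var : is_mx_cond_exp P Z (fun w => (X w - X' w) *m (X w - X' w)) V.
Hypothesis varX : {ae P, forall w,
  loewner_le (((2 * alpha)^-1)%:C *: V w) (c%:C *: X w + v%:C *: 1%:M)}.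

Lemma stein_trunc_exp theta L : 0 <= theta ->
  [/\ Pint P (fun w => retr (X w *m fcalc (trunc_exp theta L) (X w))),
      Pint P (fun w => retr (fcalc (trunc_exp theta L) (X w))) &
      (1 - c * theta) *
        Ex P (fun w => retr (X w *m fcalc (trunc_exp theta L) (X w))) <=
      v * theta * Ex P (fun w => retr (fcalc (trunc_exp theta L) (X w)))].
Proof.
move=> th0; pose h := trunc_exp theta L; pose H z := fcalc h (Psi z).
have a2 : 0 < 2 * alpha by rewrite mulr_gt0.
have hK x : `|h x| <= expR (theta * L).
  by rewrite ger0_norm ?trunc_exp_ge0 // trunc_exp_le.
have mh : @fcalc_measurable R d _ T h.
  have -> : h = (fun x => expR (theta * Num.min x L)).
    by apply/funext => x; rewrite /h trunc_expE.
  apply: fcalc_measurable_expR_comp; apply: fcalc_measurableZ.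
  exact: fcalc_measurable_min.
have mH : mx_measurable H by exact: mh.
pose K := \sum_(k < d) expR (theta * L).
have HK : mx_bounded K H.
  move=> z i j.
  have le : complex.Re `|H z i j| <= K.
    apply: (le_trans (Re_norm_fcalc _ _ _ _)); apply: ler_sum => k _; exact: hK.
  by split; apply: le_trans le; [exact: Re_norm|exact: Im_norm].
have [I1 I2 E12] := mx_cond_exp_retr mZ stein mH HK.
have [J1 J2 F12] := mx_cond_exp_retr mZ var mH HK.
have IX : Pint P (fun w => retr (X w *m H (Z w))).
  (* The Stein identity controls [alpha X]; integrability for [X] follows on dividing by [alpha]. *)
  have -> : (fun w => retr (X w *m H (Z w))) =
      (fun w => alpha^-1 * retr (alpha%:C *: X w *m H (Z w))).
    apply/funext => w; rewrite -scalemxAl retrZ.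
    by rewrite (mulKf (lt0r_neq0 alpha_gt0)).
  exact: PintZ.
have EX : Ex P (fun w => retr ((X w - X' w) *m H (Z w))) =
    alpha * Ex P (fun w => retr (X w *m H (Z w))).
  rewrite E12 -(ExZ _ IX); apply: congr1; apply/funext => w.
  by rewrite -scalemxAl retrZ.
have IH : Pint P (fun w => retr (H (Z w))).
  apply: (@Pint_bounded _ _ _ _ K).
    exact: measurableT_comp (measurable_retr mH) mZ.
  move=> w; rewrite retr_fcalc; apply: (le_trans (ler_norm_sum _ _ _)).
  by apply: ler_sum => k _; exact: hK.
split; [exact: IX|exact: IH|].
have m1 : mx_measurable (fun z : T * T => Psi z.1 - Psi z.2).
  move=> i j; have [mr mi] := mPsi i j; split.
    under eq_fun do rewrite mxE mxE ReD ReN; apply: measurable_funB.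
      exact: measurableT_comp mr measurable_fst.
    exact: measurableT_comp mr measurable_snd.
  under eq_fun do rewrite mxE mxE ImD ImN; apply: measurable_funB.
    exact: measurableT_comp mi measurable_fst.
  exact: measurableT_comp mi measurable_snd.
have mH1 : mx_measurable (fun z : T * T => H z.1).
  move=> i j; have [mr mi] := mH i j; split.
    exact: measurableT_comp mr measurable_fst.
  exact: measurableT_comp mi measurable_fst.
(* Symmetrizing [F] gives the trace of [(X - X')(h(X) - h(X'))], and symmetrizing [G] that of
   [(X - X')^2 (h(X) + h(X'))]: the two sides of [retr_mean_value]. *)
pose F (z : T * T) := retr ((Psi z.1 - Psi z.2) *m H z.1).
pose G (z : T * T) := retr ((Psi z.1 - Psi z.2) *m (Psi z.1 - Psi z.2) *m H z.1).
have mF : measurable_fun setT F by apply: measurable_retr; exact: mx_measurableM.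
have mG : measurable_fun setT G.
  by apply: measurable_retr; apply: mx_measurableM mH1; exact: mx_measurableM.
have FG z z' : F (z, z') + F (z', z) <= theta / 2 * (G (z, z') + G (z', z)).
  have := retr_mean_value (hPsi z) (hPsi z')
    (fun x y => trunc_exp_mean_value L x y th0).
  rewrite !fcalcZ -scalerDr -scalemxAr retrZ mulmxBr mulmxDr retrB retrD.
  rewrite /F /G; cbn [fst snd].
  rewrite -[Psi z' - Psi z]opprB mulNmx retrN.
  by rewrite [(- _) *m (- _)]mulNmx mulmxN opprK.
have mv := Ex_exchange_le mZ mZ' exchZ mF mG I1 J1 FG.
(* The Loewner bound is tested against the positive semidefinite matrix [h(X)]; the factor [2 alpha]
   undoes the normalization of the conditional variance. *)
have bd : Ex P (fun w => retr (V w *m H (Z w))) <=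
    2 * alpha * (c * Ex P (fun w => retr (X w *m H (Z w))) +
                 v * Ex P (fun w => retr (H (Z w)))).
  have IcX := PintZ c IX; have IvH := PintZ v IH.
  rewrite -(ExZ c IX) -(ExZ v IH) -(ExD IcX IvH) -(ExZ _ (PintD IcX IvH)).
  apply: (ae_le_Ex J2); first by apply: PintZ; exact: PintD.
  apply: filterS varX => w psdw.
  have := retr_mul_fcalc_ge0 (X w) psdw (trunc_exp_ge0 theta L).
  rewrite mulmxBl retrB mulmxDl retrD.
  rewrite -!scalemxAl !retrZ mul1mx -/(H (Z w)) subr_ge0.
  by rewrite (ler_pdivrMl _ _ a2).
have {}mv : alpha * Ex P (fun w => retr (X w *m H (Z w))) <=
    theta / 2 * Ex P (fun w => retr (V w *m H (Z w))).
  by rewrite -EX -F12.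
rewrite -(ler_pM2l alpha_gt0).
move: mv bd; rewrite -!/(H (Z _)); clear -th0.
move: (Ex P _) (Ex P _) (Ex P _) => q p r qp pqr.
have := ler_wpM2l th0 pqr => le1; lra.
Qed.

End stein.

Lemma retr_trunc_exp_tangent {R : realType} {d : nat} theta theta' g L
    (A : 'M[R[i]]_d) : A \is hermsymmx -> theta <= theta' ->
  expR (- (theta' - theta) * g) * (retr (fcalc (trunc_exp theta' L) A) -
    (theta' - theta) * (retr (A *m fcalc (trunc_exp theta' L) A) -
      g * retr (fcalc (trunc_exp theta' L) A))) <=
  retr (fcalc (trunc_exp theta L) A).
Proof.
move=> hA le; rewrite (mul_fcalc _ hA) !retr_fcalc.
rewrite mulr_sumr -sumrB mulr_sumr -sumrB mulr_sumr.
by apply: ler_sum => k _; exact: trunc_exp_tangent.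
Qed.

Lemma norm_min_nat_le {R : realType} (x : R) n : `|Num.min x n%:R| <= `|x|.
Proof.
rewrite minEle; case: ifPn => //; rewrite -ltNge => /ltW nx.
by rewrite (ger0_norm (ler0n _ _)); exact: le_trans nx (ler_norm _).
Qed.

(** * The trace moment generating function *)

(** This is the only information about the Stein pair used in bounding [m]. It is not divided by
    [1 - c * theta], so it makes sense for either sign of that factor and for negative [c]. *)
Definition trunc_mgf_ineq {R : realType} {dO : measure_display}
    {Omega : measurableType dO} (P : probability Omega R) {d : nat}
    (X : Omega -> 'M[R[i]]_d) (c v : R) : Prop :=
  forall theta L, 0 <= theta ->
  [/\ Pint P (fun w => retr (X w *m fcalc (trunc_exp theta L) (X w))),
      Pint P (fun w => retr (fcalc (trunc_exp theta L) (X w))) &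
      (1 - c * theta) *
        Ex P (fun w => retr (X w *m fcalc (trunc_exp theta L) (X w))) <=
      v * theta * Ex P (fun w => retr (fcalc (trunc_exp theta L) (X w)))].

Section trace_mgf.
Context {R : realType} {dO : measure_display} {Omega : measurableType dO}.
Variable P : probability Omega R.
Context {d : nat}.
Variables (X : Omega -> 'M[R[i]]_d) (c v : R).
Hypothesis d_gt0 : (0 < d)%N.
Hypothesis mX : mx_measurable X.
Hypothesis hX : forall w, X w \is hermsymmx.
Hypothesis IX : forall i j, Pint P (fun w => complex.Re (X w i j)) /\
  Pint P (fun w => complex.Im (X w i j)).
Hypothesis mgfX : trunc_mgf_ineq P X c v.

Definition trace_mgf L theta :=
  Ex P (fun w => retr (fcalc (trunc_exp theta L) (X w))).

Lemma retr_trunc_exp_ge0 theta L (A : 'M[R[i]]_d) :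
  0 <= retr (fcalc (trunc_exp theta L) A).
Proof. by rewrite retr_fcalc sumr_ge0 // => k _; exact: trunc_exp_ge0. Qed.

Lemma trace_mgf_ge0 L theta : 0 <= trace_mgf L theta.
Proof. by apply: Ex_ge0 => w; exact: retr_trunc_exp_ge0. Qed.

Lemma trace_mgf0 L : trace_mgf L 0 = d%:R.
Proof.
rewrite /trace_mgf -[RHS](Ex_cst P); congr Ex; apply/funext => w.
rewrite retr_fcalc (eq_bigr (fun=> 1)) => [|k _]; last first.
  by rewrite trunc_expE mul0r expR0.
by rewrite sumr_const card_ord.
Qed.

(** The differential inequality is used only at the right end [theta']: there it makes the linear
    term of the averaged tangent bound favorable, leaving a comparison of the two values of [m]. *)
Lemma trace_mgf_step L theta theta' g : 0 <= theta -> theta <= theta' ->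
  0 < 1 - c * theta' -> v * theta' <= g * (1 - c * theta') ->
  trace_mgf L theta' <= expR ((theta' - theta) * g) * trace_mgf L theta.
Proof.
move=> th0 thth' c1 vg.
have th'0 := le_trans th0 thth'.
have [I1 I2 E] := mgfX L th'0; have [_ I0 _] := mgfX L th0.
rewrite -/(trace_mgf L theta') in E.
have m0 := trace_mgf_ge0 L theta'.
have {}E : Ex P (fun w => retr (X w *m fcalc (trunc_exp theta' L) (X w))) <=
    g * trace_mgf L theta'.
  rewrite -(ler_pM2l c1); apply: (le_trans E).
  by rewrite mulrA [_ * g]mulrC ler_wpM2r.
rewrite -(ler_pM2l (expR_gt0 (- (theta' - theta) * g))) mulrA -expRD.
rewrite -mulrDl addNr mul0r expR0 mul1r.
have IZ := PintB I1 (PintZ g I2).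
have IB := PintB I2 (PintZ (theta' - theta) IZ).
apply: (@le_trans _ _ (expR (- (theta' - theta) * g) *
  Ex P (fun w => retr (fcalc (trunc_exp theta' L) (X w)) - (theta' - theta) *
    (retr (X w *m fcalc (trunc_exp theta' L) (X w)) -
     g * retr (fcalc (trunc_exp theta' L) (X w)))))).
  rewrite ler_wpM2l ?expR_ge0 // (ExB I2 (PintZ (theta' - theta) IZ)).
  rewrite (ExZ _ IZ) (ExB I1 (PintZ g I2)) (ExZ _ I2) lerDl oppr_ge0.
  by rewrite mulr_ge0_le0 ?subr_ge0 // subr_le0.
rewrite -(ExZ _ IB); apply: le_Ex; [exact: PintZ|exact: I0|] => w.
exact: retr_trunc_exp_tangent (hX w) thth'.
Qed.

Lemma trace_mgf_le (g G : R -> R) L tau : 0 <= tau ->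
  (forall x, 0 <= x <= tau -> 0 < 1 - c * x /\ v * x <= g x * (1 - c * x)) ->
  (forall x y, 0 <= x -> x <= y -> y <= tau -> (y - x) * g x <= G y - G x) ->
  trace_mgf L tau <= expR (G tau - G 0) * d%:R.
Proof.
move=> tau0 hg hG; rewrite -(trace_mgf0 L).
apply: (@discrete_gronwall _ (trace_mgf L) g) => // [x _|x y x0 xy yt].
  exact: trace_mgf_ge0.
have [|? ?] := hg y; first by rewrite yt (le_trans x0).
exact: trace_mgf_step.
Qed.

Lemma measurable_lambda_max_le t :
  measurable [set w | t <= lambda_max (X w)].
Proof.
rewrite -[X in measurable X]setTI; apply: measurable_fun_le => //.
exact: measurable_lambda_max.
Qed.

(** The left side is one of the positive summands of the trace. *)
Lemma lambda_max_trunc_exp theta L w :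
  expR (theta * Num.min (lambda_max (X w)) L) <=
  retr (fcalc (trunc_exp theta L) (X w)).
Proof.
have [k -> _] := lambda_maxP d_gt0 (hX w).
rewrite retr_fcalc (bigD1 k) //= trunc_expE lerDl sumr_ge0 // => j _.
exact: trunc_exp_ge0.
Qed.

Lemma lambda_max_tail theta t b : 0 <= theta ->
  trace_mgf t theta <= expR b * d%:R ->
  (P [set w | (t <= lambda_max (X w))%R] <=
    (d%:R * expR (- (theta * t) + b))%:E)%E.
Proof.
move=> th0 mb; set B := [set w | _].
have mB : measurable B by exact: measurable_lambda_max_le.
have [_ I _] := mgfX t th0.
have -> : P B = (Ex P (fun w => \1_B w))%:E.
  rewrite EFin_Ex ?expectation_indic //; apply: (@Pint_bounded _ _ _ _ 1).
    exact: measurable_indic.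
  by move=> w; rewrite indicE ger0_norm ?ler0n //; case: (_ \in _).
rewrite lee_fin expRD mulrC -mulrA.
apply: (@le_trans _ _ (expR (- (theta * t)) * trace_mgf t theta)); last first.
  by rewrite ler_wpM2l ?expR_ge0.
rewrite -(ExZ _ I); apply: le_Ex => [||w].
- apply: (@Pint_bounded _ _ _ _ 1); first exact: measurable_indic.
  by move=> w; rewrite indicE ger0_norm ?ler0n //; case: (_ \in _).
- exact: PintZ.
rewrite indicE; have [|_] := boolP (w \in B); last first.
  by rewrite mulr_ge0 ?expR_ge0 ?retr_trunc_exp_ge0.
rewrite inE /B /= => tw; rewrite expRN -(ler_pM2l (expR_gt0 (theta * t))).
rewrite mulrA divff ?gt_eqF ?expR_gt0 // mul1r mulr1.
by apply: le_trans (lambda_max_trunc_exp _ _ _); rewrite min_r.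
Qed.

Lemma Pint_lambda_max : Pint P (fun w => lambda_max (X w)).
Proof.
have IS : Pint P (fun w => \sum_i \sum_j
    (`|complex.Re (X w i j)| + `|complex.Im (X w i j)|)).
  apply: Pint_sum => i; apply: Pint_sum => j; have [? ?] := IX i j.
  by apply: PintD; exact: integrable_norm.
apply: (le_integrable measurableT _ _ IS).
  by apply/measurable_EFinP; exact: measurable_lambda_max.
move=> w _; have [k ek _] := lambda_maxP d_gt0 (hX w).
by rewrite /= lee_fin ek; apply: le_trans (eigs_le _ (hX w)) (ler_norm _).
Qed.

(** Expectations, unlike tails, require the truncation to be removed; the absolute value of the
    largest eigenvalue dominates. *)
Lemma Ex_min_lambda_max_cvg :
  Ex P (fun w => Num.min (lambda_max (X w)) n%:R) @[n --> \oo] -->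
  Ex P (fun w => lambda_max (X w)).
Proof.
have I := Pint_lambda_max; have mL := Pint_measurable I.
apply: fine_cvg; rewrite fineK; last exact: integrable_fin_num I.
apply: (@dominated_cvg _ _ _ P setT measurableT
  (fun n w => (Num.min (lambda_max (X w)) n%:R)%:E)
  (fun w => (lambda_max (X w))%:E) (fun w => `|(lambda_max (X w))%:E|%E)).
- by move=> n; apply/measurable_EFinP; exact: measurable_minr.
- move=> w _; apply: cvg_EFin; first exact: nearW.
  apply: cvg_near_cst; near=> n; apply/min_idPl.
  by near: n; exact: nbhs_infty_ger.
- by [].
- exact: integrable_abse I.
- by move=> n w _; rewrite lee_fin norm_min_nat_le.
Unshelve. all: by end_near. Qed.

(* Jensen's inequality for [expR], through its tangent line at [b + ln d]. *)
Lemma Ex_lambda_max_le theta b : 0 < theta ->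
  (forall L, 0 <= L -> trace_mgf L theta <= expR b * d%:R) ->
  (Ex P (fun w => lambda_max (X w)) <= (b + ln d%:R) / theta)%R.
Proof.
move=> th0 mb; have dR : 0 < d%:R :> R by rewrite ltr0n.
apply: (cvgr_to_le Ex_min_lambda_max_cvg); apply: nearW => n.
have mle := mb n%:R (ler0n _ _).
have [_ I _] := mgfX n%:R (ltW th0).
set B := b + ln d%:R; have eB : expR b * d%:R = expR B.
  by rewrite /B expRD lnK.
rewrite eB {eB} in mle; clearbody B.
have Im : Pint P (fun w => Num.min (lambda_max (X w)) n%:R).
  have IL := Pint_lambda_max.
  apply: (le_integrable measurableT _ _ (integrable_norm IL)).
    by apply/measurable_EFinP/measurable_minr => //; exact: Pint_measurable IL.
  move=> w _; rewrite /= lee_fin normr_id.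
  exact: norm_min_nat_le.
rewrite ler_pdivlMr // mulrC.
have IL : Pint P (fun w => expR B *
    ((1 - B) + theta * Num.min (lambda_max (X w)) n%:R)).
  by apply: PintZ; apply: PintD; [exact: Pint_cst|exact: PintZ].
have : expR B * ((1 - B) +
    theta * Ex P (fun w => Num.min (lambda_max (X w)) n%:R)) <= expR B * 1.
  rewrite mulr1; apply: le_trans mle.
  rewrite -(ExZ theta Im) -[X in X + _](Ex_cst P).
  rewrite -(ExD (Pint_cst P _) (PintZ theta Im)).
  rewrite -(ExZ _ (PintD (Pint_cst P _) (PintZ theta Im))).
  apply: le_Ex => // w; apply: le_trans (lambda_max_trunc_exp _ _ _).
  move: (theta * _) => u; rewrite -[X in _ <= expR X](subrKC B).
  rewrite expRD ler_wpM2l ?expR_ge0 //.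
  by apply: le_trans (expR_ge1Dx _); lra.
by rewrite (ler_pM2l (expR_gt0 B)); lra.
Qed.

End trace_mgf.

(** * Tail functions *)

Section rate.
Context {R : realType}.
Implicit Types (x y z u w t c v l : R).

Lemma ln_le_subr1 x : 0 < x -> ln x <= x - 1.
Proof. by move=> x0; have := expR_ge1Dx (ln x); rewrite lnK ?posrE //; lra. Qed.

(* The primitive of [x |-> v x / (1 - c x)] vanishing at [0]. *)
Definition mgf_rate c v x : R :=
  if c == 0 then v * x ^+ 2 / 2 else - (v / c ^+ 2) * (ln (1 - c * x) + c * x).

Lemma mgf_rate0 c v : mgf_rate c v 0 = 0.
Proof.
rewrite /mgf_rate; case: ifP => _; first by rewrite expr0n /= mulr0 mul0r.
by rewrite mulr0 subr0 ln1 addr0 mulr0.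
Qed.

(** The rate is convex, so it lies above its tangent at [x]; for [c != 0] this is [ln s <= s - 1] at
    [s = (1 - c y) / (1 - c x)]. *)
Lemma mgf_rate_tangent c v x y : 0 <= c -> 0 <= v -> 0 <= x -> x <= y ->
  c * y < 1 -> (y - x) * (v * x / (1 - c * x)) <= mgf_rate c v y - mgf_rate c v x.
Proof.
move=> c0 v0 x0 xy cy1; rewrite /mgf_rate; case: eqVneq => [->|cN0].
  rewrite mul0r subr0 divr1; have := sqr_ge0 (y - x) => /(ler_wpM2l v0); lra.
have cx1 : c * x < 1 by apply: le_lt_trans cy1; rewrite ler_wpM2l.
have p0 : 0 < 1 - c * x by lra.
have q0 : 0 < 1 - c * y by lra.
have := @ln_le_subr1 ((1 - c * y) / (1 - c * x)); rewrite divr_gt0 // => /(_ isT).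
rewrite ln_div ?posrE // => lnle.
have vc0 : 0 <= v / c ^+ 2 by rewrite divr_ge0 // sqr_ge0.
have {lnle} := ler_wpM2l vc0 lnle.
have -> : (y - x) * (v * x / (1 - c * x)) =
    v / c ^+ 2 * (1 - (1 - c * y) / (1 - c * x) - c * (y - x)).
  by field; rewrite cN0 gt_eqF.
lra.
Qed.

(** For [c != 0] this is [ln_le_half] at [s = (1 - c x)^-1]. *)
Lemma mgf_rate_le c v x : 0 <= c -> 0 <= v -> 0 <= x -> c * x < 1 ->
  mgf_rate c v x <= v * x ^+ 2 / (2 * (1 - c * x)).
Proof.
move=> c0 v0 x0 cx1; rewrite /mgf_rate; case: eqVneq => [->|cN0].
  by rewrite mul0r subr0 mulr1.
have p0 : 0 < 1 - c * x by lra.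
have cx0 : 0 <= c * x by rewrite mulr_ge0.
have s1 : 1 <= (1 - c * x)^-1 by rewrite invf_ge1 //; lra.
have := ln_le_half s1; rewrite invrK lnV ?posrE // => lnle.
have vc0 : 0 <= v / c ^+ 2 by rewrite divr_ge0 // sqr_ge0.
have {lnle} := ler_wpM2l vc0 lnle.
have -> : v * x ^+ 2 / (2 * (1 - c * x)) =
    v / c ^+ 2 * (((1 - c * x)^-1 - (1 - c * x)) / 2 - c * x).
  by field; rewrite cN0 gt_eqF.
lra.
Qed.

(* The function whose right extension at [u = 0] is [log_tail c ^~ t]. *)
Definition log_tail_fun c t u : R :=
  if c == 0 then expR (- t ^+ 2 / (2 * u))
  else expR (- (t / c) + u / c ^+ 2 * ln (1 + c * t / u)).

(** This [x] minimizes the exponent: it solves [v x / (1 - c x) = t]. *)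
Lemma log_tail_funE c v t : 0 <= c -> 0 < v -> 0 <= t ->
  let x := t / (v + c * t) in
  log_tail_fun c t v = expR (- (x * t) + mgf_rate c v x).
Proof.
move=> c0 v0 t0 x; rewrite /log_tail_fun /mgf_rate; case: eqVneq => [e|cN0].
  by congr expR; rewrite /x e mul0r addr0; field; rewrite gt_eqF.
have ct0 : 0 <= c * t by rewrite mulr_ge0.
have vct : 0 < v + c * t by lra.
have -> : 1 - c * x = (1 + c * t / v)^-1.
  rewrite /x; field; rewrite !gt_eqF //=.
rewrite lnV ?posrE; last by rewrite ltr_pwDl // divr_ge0 // ltW.
congr expR; rewrite /x; field; rewrite cN0 gt_eqF //.
Qed.

(** At [s = 1 + c t / v], [ln_le_half] gives exactly the Bernstein exponent. *)
Lemma log_tail_fun_le_bernstein c v t : 0 <= c -> 0 < v -> 0 <= t ->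
  log_tail_fun c t v <= expR (- t ^+ 2 / (2 * v + 2 * c * t)).
Proof.
move=> c0 v0 t0; rewrite /log_tail_fun; case: eqVneq => [->|cN0].
  by rewrite mulr0 mul0r addr0.
have ct0 : 0 <= c * t by rewrite mulr_ge0.
have vct : 0 < v + c * t by lra.
have s1 : 1 <= 1 + c * t / v by rewrite lerDl divr_ge0 // ltW.
have vc0 : 0 <= v / c ^+ 2 by rewrite divr_ge0 ?sqr_ge0 // ltW.
have := ler_wpM2l vc0 (ln_le_half s1); rewrite ler_expR.
have -> : - t ^+ 2 / (2 * v + 2 * c * t) =
    - (t / c) + v / c ^+ 2 * ((1 + c * t / v - (1 + c * t / v)^-1) / 2).
  by field; rewrite cN0 !gt_eqF //= -mulrA -mulrDr mulr_gt0.
lra.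
Qed.

Lemma gauss_exponent_homo t u w a : 0 <= a -> 0 < u -> u <= w ->
  expR (- t ^+ 2 / (2 * u + a)) <= expR (- t ^+ 2 / (2 * w + a)).
Proof.
move=> a0 u0 uw; rewrite ler_expR !mulNr lerN2 ler_wpM2l ?sqr_ge0 //.
by rewrite lef_pV2 ?posrE; lra.
Qed.

Lemma log_tail_fun_homo c t u w : 0 <= c -> 0 <= t -> 0 < u -> u <= w ->
  log_tail_fun c t u <= log_tail_fun c t w.
Proof.
move=> c0 t0 u0 uw; rewrite /log_tail_fun; case: eqVneq => [e|cN0].
  by have := @gauss_exponent_homo t u w 0; rewrite !addr0; apply.
have w0 : 0 < w by lra.
have a0 : 0 <= c * t by rewrite mulr_ge0.
rewrite ler_expR lerD2l -mulrA -[leRHS]mulrA mulrCA [leRHS]mulrCA.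
rewrite ler_wpM2l ?invr_ge0 ?sqr_ge0 //.
move: (c * t) a0 => a a0.
have y0 : 0 < 1 + a / w by rewrite ltr_pwDl // divr_ge0 // ltW.
have z0 : 0 < 1 + a / u by rewrite ltr_pwDl // divr_ge0 // ltW.
(* Jensen's inequality for [ln]: [1 + a / w] is the mean of [1 + a / u] and [1] with weights [u / w]
   and [(w - u) / w]. The tangent bounds at these two points, weighted by [u] and [w - u],
   cancel. *)
have l1 := @ln_le_subr1 ((1 + a / u) / (1 + a / w)).
have l2 := @ln_le_subr1 (1 + a / w)^-1.
rewrite divr_gt0 // ln_div ?posrE // in l1; rewrite invr_gt0 y0 lnV ?posrE // in l2.
have {}l1 := ler_wpM2l (ltW u0) (l1 isT).
have wu : 0 <= w - u by lra.
have {}l2 := ler_wpM2l wu (l2 isT).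
have e : u * ((1 + a / u) / (1 + a / w) - 1) = - ((w - u) * ((1 + a / w)^-1 - 1)).
  field; rewrite !gt_eqF //; lra.
lra.
Qed.

Lemma log_tail_fun_ge0 c t u : 0 <= log_tail_fun c t u.
Proof. by rewrite /log_tail_fun; case: ifP => _; exact: expR_ge0. Qed.

(** This ensures that the [lim] in [right_ext] is a genuine limit and not a default value. *)
Lemma homo_at_right_cvg (f : R -> R) : (forall u, 0 < u -> 0 <= f u) ->
  (forall u w, 0 < u -> u <= w -> f u <= f w) -> cvg (f u @[u --> 0^'+]).
Proof.
move=> f0 fh; apply: nondecreasing_at_right_is_cvgr; apply: nearW => x.
  by move=> u w; rewrite !in_itv /= => /andP[u0 _] _; exact: fh.
by exists 0 => y [u]; rewrite /= in_itv /= => /andP[u0 _] <-; exact: f0.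
Qed.

(** A bound valid for all positive parameters [u >= v] covers [v > 0] and [v = 0] at once. *)
Lemma right_ext_ge (f : R -> R) v x : 0 <= v ->
  (forall u, 0 < u -> 0 <= f u) ->
  (forall u w, 0 < u -> u <= w -> f u <= f w) ->
  (forall u, 0 < u -> v <= u -> x <= f u) -> x <= right_ext f v.
Proof.
move=> v0 f0 fh xf; rewrite /right_ext; case: eqVneq => [v00|vN0]; last first.
  by apply: xf => //; rewrite lt_def vN0.
apply: limr_ge; first exact: homo_at_right_cvg.
near=> u; have u0 : 0 < u by near: u; exact: nbhs_right_gt.
by apply: xf; rewrite // v00 ltW.
Unshelve. all: by end_near. Qed.

Lemma log_tail_le_bernstein c v t : 0 <= c -> 0 <= v -> 0 <= t ->
  log_tail c v t <= bernstein_tail c v t.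
Proof.
move=> c0 v0 t0; apply: right_ext_ge => [//|u _|u w u0 uw|u u0 vu].
- exact: expR_ge0.
- by apply: gauss_exponent_homo => //; rewrite !mulr_ge0.
rewrite /log_tail /right_ext -/(log_tail_fun c t v).
case: eqVneq => [v00|vN0]; last first.
  apply: (@le_trans _ _ (log_tail_fun c t u)); last first.
    exact: log_tail_fun_le_bernstein.
  by apply: log_tail_fun_homo => //; rewrite lt_def vN0.
apply: limr_le.
  apply: homo_at_right_cvg => [w w0|w z w0 wz].
    exact: log_tail_fun_ge0.
  exact: log_tail_fun_homo.
near=> w; have w0 : 0 < w by near: w; exact: nbhs_right_gt.
apply: (@le_trans _ _ (log_tail_fun c t u)); last first.
  exact: log_tail_fun_le_bernstein.
apply: log_tail_fun_homo => //.
by near: w; exact: nbhs_right_le.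
Unshelve. all: by end_near. Qed.

(** The right side is the infimum over [s]. If exactly one of [v] and [l] vanishes it is not
    attained, hence the approximate witnesses in the degenerate cases. *)
Lemma le_sqrt_opt x v l : 0 <= v -> 0 <= l ->
  (forall s, 0 < s -> x <= v * s / 2 + l / s) -> x <= Num.sqrt (2 * v * l).
Proof.
move=> v0 l0 xs.
have [vz|vN0] := eqVneq v 0.
  rewrite vz mulr0 mul0r sqrtr0; apply/ler_addgt0Pr => e e0; rewrite add0r.
  (* Adding 1 keeps the witness positive when [l = 0] and still gives [l / s <= e]. *)
  have s0 : 0 < (l + 1) / e by rewrite divr_gt0 // ltr_wpDl.
  apply: (le_trans (xs _ s0)); rewrite vz mul0r mul0r add0r invf_div mulrA.
  by rewrite ler_pdivrMr ?ltr_wpDl // mulrC; rewrite ler_wpM2l ?(ltW e0) //; lra.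
have vp : 0 < v by rewrite lt_def vN0.
have [lz|lN0] := eqVneq l 0.
  rewrite lz mulr0 sqrtr0; apply/ler_addgt0Pr => e e0; rewrite add0r.
  have s0 : 0 < 2 * e / v by rewrite divr_gt0 // mulr_gt0.
  apply: (le_trans (xs _ s0)); rewrite lz mul0r addr0.
  by have -> : v * (2 * e / v) / 2 = e by field.
have lp : 0 < l by rewrite lt_def lN0.
(* At [s = q / v] both summands equal [q / 2]. *)
set q := Num.sqrt _; have q0 : 0 < q by rewrite sqrtr_gt0 !mulr_gt0.
have qq : q ^+ 2 = 2 * v * l by rewrite sqr_sqrtr // ltW // !mulr_gt0.
have s0 : 0 < q / v by rewrite divr_gt0.
apply: (le_trans (xs _ s0)).
have -> : l = q ^+ 2 / (2 * v) by rewrite qq; field.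
suff -> : v * (q / v) / 2 + q ^+ 2 / (2 * v) / (q / v) = q by [].
by field; rewrite vN0 gt_eqF.
Qed.

End rate.

(** * Concentration inequalities *)

(* [b] may be negative: the lower tail of [X] is the upper tail of [- X], for
   which the lemmas below are used with [- c] for [b] and [0] for [c]. *)
Section tails_of_trace_mgf.
Context {R : realType} {dO : measure_display} {Omega : measurableType dO}.
Variable P : probability Omega R.
Context {d : nat}.
Variables (X : Omega -> 'M[R[i]]_d) (b c v : R).
Hypothesis d_gt0 : (0 < d)%N.
Hypothesis mX : mx_measurable X.
Hypothesis hX : forall w, X w \is hermsymmx.
Hypothesis IX : forall i j, Pint P (fun w => complex.Re (X w i j)) /\
  Pint P (fun w => complex.Im (X w i j)).
Hypothesis c_ge0 : 0 <= c.
Hypothesis v_ge0 : 0 <= v.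
Hypothesis bc : b <= c.
Hypothesis mgfX : trunc_mgf_ineq P X b v.

Lemma trunc_mgf_ineq_weaken u : v <= u -> trunc_mgf_ineq P X b u.
Proof.
move=> vu theta L th0; have [I1 I2 le] := mgfX L th0.
split; [exact: I1|exact: I2|].
apply: (le_trans le); apply: ler_wpM2r; first exact: trace_mgf_ge0.
exact: ler_wpM2r.
Qed.

Lemma trace_mgf_rate u L tau : v <= u -> 0 <= tau -> c * tau < 1 ->
  trace_mgf P X L tau <= expR (mgf_rate c u tau) * d%:R.
Proof.
move=> vu tau0 ct1; have u0 := le_trans v_ge0 vu.
have := trace_mgf_le hX (trunc_mgf_ineq_weaken vu) L
  (g := fun x => u * x / (1 - c * x)) (G := mgf_rate c u) tau0.
rewrite mgf_rate0 subr0; apply=> [x /andP[x0 xt]|x y x0 xy yt].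
  have cx : c * x < 1 by apply: le_lt_trans ct1; rewrite ler_wpM2l.
  (* Since [b <= c], the true denominator [1 - b x] is at least [1 - c x], so the rate for [c] also
     serves for [b]. *)
  have bx : b * x <= c * x by rewrite ler_wpM2r.
  split; first by lra.
  have p0 : 0 < 1 - c * x by lra.
  rewrite mulrAC -mulrA ler_peMr ?mulr_ge0 // ler_pdivlMr // mul1r; lra.
apply: mgf_rate_tangent => //.
by apply: le_lt_trans ct1; rewrite ler_wpM2l.
Qed.

Lemma lambda_max_log_tail t : 0 <= t ->
  (P [set w | (t <= lambda_max (X w))%R] <= (d%:R * log_tail c v t)%:E)%E.
Proof.
move=> t0; have mB := measurable_lambda_max_le d_gt0 mX hX t.
have dR : 0 < d%:R :> R by rewrite ltr0n.
rewrite -(fineK (fin_num_measure P _ mB)) lee_fin mulrC -ler_pdivrMr //.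
rewrite /log_tail; apply: right_ext_ge => //.
- by move=> u _; exact: log_tail_fun_ge0.
- by move=> u w u0 uw; exact: log_tail_fun_homo.
move=> u u0 vu; rewrite -/(log_tail_fun c t u) log_tail_funE //.
set x := t / (u + c * t).
have ct0 : 0 <= c * t by rewrite mulr_ge0.
have uct : 0 < u + c * t by lra.
have x0 : 0 <= x by rewrite divr_ge0 // ltW.
have cx1 : c * x < 1 by rewrite mulrA ltr_pdivrMr // mul1r; lra.
have le := lambda_max_tail d_gt0 mX hX (trunc_mgf_ineq_weaken vu) x0
  (trace_mgf_rate t vu x0 cx1).
by rewrite ler_pdivrMr // [leRHS]mulrC -lee_fin (fineK (fin_num_measure P _ mB)).
Qed.

Lemma Ex_lambda_max_sqrt :
  Ex P (fun w => lambda_max (X w)) <=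
  Num.sqrt (2 * v * ln d%:R) + c * ln d%:R.
Proof.
have l0 : 0 <= ln d%:R :> R by rewrite ln_ge0 // ler1n.
rewrite -lerBlDr; apply: le_sqrt_opt => // s s0.
have cs0 : 0 <= c * s by rewrite mulr_ge0 // ltW.
have cs1 : 0 < 1 + c * s by lra.
(* With this substitution [1 - c x = (1 + c s)^-1], and the bound splits into [v s / 2 + ln d / s],
   to be optimized in [s], and the constant [c ln d]. *)
pose x := s / (1 + c * s).
have x0 : 0 < x by rewrite divr_gt0.
have cx1 : c * x < 1 by rewrite mulrA ltr_pdivrMr // mul1r; lra.
have := Ex_lambda_max_le d_gt0 mX hX IX mgfX x0
  (fun L _ => trace_mgf_rate L (lexx v) (ltW x0) cx1).
move=> /le_trans le; rewrite lerBlDr; apply: le.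
rewrite ler_pdivrMr //.
have := mgf_rate_le c_ge0 v_ge0 (ltW x0) cx1.
have -> : v * x ^+ 2 / (2 * (1 - c * x)) = v * s / 2 * x.
  by rewrite /x; field; rewrite !gt_eqF //; lra.
have -> : (v * s / 2 + ln d%:R / s + c * ln d%:R) * x = v * s / 2 * x + ln d%:R.
  by rewrite /x; field; rewrite !gt_eqF.
lra.
Qed.

End tails_of_trace_mgf.

Section stein_concentration.
Context {R : realType} {dO : measure_display} {Omega : measurableType dO}.
Variable P : probability Omega R.
Context {dT : measure_display} {T : measurableType dT} {d : nat}.
Variables (Z Z' : Omega -> T) (Psi : T -> 'M[R[i]]_d) (V : Omega -> 'M[R[i]]_d).
Variables (alpha b c v : R).
Hypothesis d_gt0 : (0 < d)%N.
Hypothesis mZ : measurable_fun setT Z.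
Hypothesis mZ' : measurable_fun setT Z'.
Hypothesis exchZ : forall B : set (T * T), measurable B ->
  pushforward P (fun w => (Z w, Z' w)) B =
  pushforward P (fun w => (Z' w, Z w)) B.
Hypothesis mPsi : mx_measurable Psi.
Hypothesis hPsi : forall z, Psi z \is hermsymmx.
Hypothesis alpha_gt0 : 0 < alpha.
Hypothesis stein : is_mx_cond_exp P Z (fun w => Psi (Z w) - Psi (Z' w))
  (fun w => alpha%:C *: Psi (Z w)).
Hypothesis var : is_mx_cond_exp P Z
  (fun w => (Psi (Z w) - Psi (Z' w)) *m (Psi (Z w) - Psi (Z' w))) V.
Hypothesis varX : {ae P, forall w,
  loewner_le (((2 * alpha)^-1)%:C *: V w) (b%:C *: Psi (Z w) + v%:C *: 1%:M)}.
Hypothesis c_ge0 : 0 <= c.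
Hypothesis v_ge0 : 0 <= v.
Hypothesis bc : b <= c.

Lemma stein_Pint i j : Pint P (fun w => complex.Re (Psi (Z w) i j)) /\
  Pint P (fun w => complex.Im (Psi (Z w) i j)).
Proof.
have [[_ Ir _ _] [_ Ii _ _]] := stein i j; split.
  have -> : (fun w => complex.Re (Psi (Z w) i j)) =
      (fun w => alpha^-1 * complex.Re ((alpha%:C *: Psi (Z w)) i j)).
    by apply/funext => w; rewrite [in RHS]mxE ReZ (mulKf (lt0r_neq0 alpha_gt0)).
  exact: PintZ.
have -> : (fun w => complex.Im (Psi (Z w) i j)) =
    (fun w => alpha^-1 * complex.Im ((alpha%:C *: Psi (Z w)) i j)).
  by apply/funext => w; rewrite [in RHS]mxE ImZ (mulKf (lt0r_neq0 alpha_gt0)).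
exact: PintZ.
Qed.

Let mX : mx_measurable (fun w => Psi (Z w)).
Proof.
move=> i j; have [mr mi] := mPsi i j.
by split; [exact: measurableT_comp mr mZ|exact: measurableT_comp mi mZ].
Qed.

Let mgfX := stein_trunc_exp mZ mZ' exchZ mPsi hPsi alpha_gt0 stein var varX.

Lemma stein_lambda_max_tail t : 0 <= t ->
  (P [set w | (t <= lambda_max (Psi (Z w)))%R] <= (d%:R * log_tail c v t)%:E)%E.
Proof.
by move=> t0; apply: (lambda_max_log_tail d_gt0 mX _ c_ge0 v_ge0 bc mgfX t0).
Qed.

Lemma stein_Ex_lambda_max :
  Pint P (fun w => lambda_max (Psi (Z w))) /\
  Ex P (fun w => lambda_max (Psi (Z w))) <=
    Num.sqrt (2 * v * ln d%:R) + c * ln d%:R.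
Proof.
have hX w := hPsi (Z w); split.
  exact: (Pint_lambda_max d_gt0 mX hX stein_Pint).
exact: (Ex_lambda_max_sqrt d_gt0 mX hX stein_Pint c_ge0 v_ge0 bc mgfX).
Qed.

End stein_concentration.

Theorem theorem4p1 (R : realType) (dO : measure_display)
  (Omega : measurableType dO) (P : probability Omega R)
  (T : ptopologicalType) (Z Z' : {RV P >-> borel T})
  (d : nat) (d_gt0 : (0 < d)%N) (Psi : T -> 'M[R[i]]_d) (alpha : R)
  (X X' Delta : Omega -> 'M[R[i]]_d)
  (steinX : matrix_stein_pair Z Z' Psi alpha X X')
  (varX : is_cond_variance P Z alpha X X' Delta)
  (c v : R) (c_ge0 : 0 <= c) (v_ge0 : 0 <= v)
  (DeltaX : {ae P, forall w,
     loewner_le (Delta w) (c%:C *: X w + v%:C *: 1%:M)}) :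
  (forall t : R, 0 <= t ->
    [/\ (P [set w | (lambda_min (X w) <= - t)%R]
           <= (d%:R * gauss_tail v t)%:E)%E,
        (P [set w | (t <= lambda_max (X w))%R]
           <= (d%:R * log_tail c v t)%:E)%E &
        d%:R * log_tail c v t <= d%:R * bernstein_tail c v t]) /\
  ((- Num.sqrt (2 * v * ln d%:R))%:E <= 'E_P[fun w => lambda_min (X w)])%E /\
  ('E_P[fun w => lambda_max (X w)]
     <= (Num.sqrt (2 * v * ln d%:R) + c * ln d%:R)%:E)%E.
Proof.
have [_ exZ hPsi mPsi eX eX' /andP[alpha_gt0 _] _ steinI] := steinX.
have [V varV eDelta] := varX.
have EX : X = fun w => Psi (Z w) by apply/funext.
have EX' : X' = fun w => Psi (Z' w) by apply/funext.
subst X X'.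
have mZ : measurable_fun setT (Z : Omega -> borel T) by exact: measurable_funP.
have mZ' : measurable_fun setT (Z' : Omega -> borel T) by exact: measurable_funP.
have {}DeltaX : {ae P, forall w, loewner_le (((2 * alpha)^-1)%:C *: V w)
    (c%:C *: Psi (Z w) + v%:C *: 1%:M)}.
  by apply: filterS DeltaX => w; rewrite eDelta.
(* The negated pair satisfies the Stein identity with the same [alpha], and its squared differences,
   hence [V], are unchanged. Only the bound is rewritten, as [c X = (- c)(- X)]. *)
pose Psi' z := - Psi z.
have hPsi' z : Psi' z \is hermsymmx by exact: hermsymmxN.
have mPsi' : mx_measurable (Psi' : borel T -> 'M[R[i]]_d) by exact: mx_measurableN.
have steinI' : is_mx_cond_exp P (Z : Omega -> borel T)
    (fun w => Psi' (Z w) - Psi' (Z' w)) (fun w => alpha%:C *: Psi' (Z w)).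
  have -> : (fun w => Psi' (Z w) - Psi' (Z' w)) =
      (fun w => - (Psi (Z w) - Psi (Z' w))).
    by apply/funext => w; rewrite opprD.
  have -> : (fun w => alpha%:C *: Psi' (Z w)) =
      (fun w => - (alpha%:C *: Psi (Z w))).
    by apply/funext => w; rewrite scalerN.
  exact: mx_cond_expN.
have varV' : is_mx_cond_exp P (Z : Omega -> borel T) (fun w =>
    (Psi' (Z w) - Psi' (Z' w)) *m (Psi' (Z w) - Psi' (Z' w))) V.
  have -> : (fun w => (Psi' (Z w) - Psi' (Z' w)) *m (Psi' (Z w) - Psi' (Z' w))) =
      (fun w => (Psi (Z w) - Psi (Z' w)) *m (Psi (Z w) - Psi (Z' w))).
    by apply/funext => w; rewrite -opprD mulNmx mulmxN opprK.
  exact: varV.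
have DeltaX' : {ae P, forall w, loewner_le (((2 * alpha)^-1)%:C *: V w)
    ((- c)%:C *: Psi' (Z w) + v%:C *: 1%:M)}.
  apply: filterS DeltaX => w.
  by rewrite [(- c)%:C](rmorphN (real_complex R)) scaleNr scalerN opprK.
have c'0 : - c <= 0 by rewrite oppr_le0.
split=> [t t0|]; last split.
- split.
  + have := stein_lambda_max_tail d_gt0 mZ mZ' exZ mPsi' hPsi' alpha_gt0 steinI'
      varV' DeltaX' (lexx 0) v_ge0 c'0 t0.
    have -> : log_tail 0 v t = gauss_tail v t.
      by rewrite /log_tail /gauss_tail eqxx.
    apply: le_trans; rewrite le_eqVlt; apply/orP; left; apply/eqP.
    congr (P _); apply/seteqP; split=> w /=; rewrite lambda_minN /Psi'; lra.
  + have := stein_lambda_max_tail d_gt0 mZ mZ' exZ mPsi hPsi alpha_gt0 steinI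
      varV DeltaX c_ge0 v_ge0 (lexx c) t0; by apply.
  + by apply: ler_wpM2l; [exact: ler0n|exact: log_tail_le_bernstein].
- have [I le] := stein_Ex_lambda_max d_gt0 mZ mZ' exZ mPsi' hPsi' alpha_gt0 steinI'
    varV' DeltaX' (lexx 0) v_ge0 c'0.
  have -> : (fun w => lambda_min (Psi (Z w))) =
      (fun w => - lambda_max (Psi' (Z w))).
    by apply/funext => w; rewrite lambda_minN.
  rewrite -EFin_Ex; last exact: PintN.
  by rewrite lee_fin ExN // lerN2 (le_trans le) // mul0r addr0.
have [I le] := stein_Ex_lambda_max d_gt0 mZ mZ' exZ mPsi hPsi alpha_gt0 steinI
  varV DeltaX c_ge0 v_ge0 (lexx c).
by rewrite -EFin_Ex // lee_fin.
Qed.
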